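(* Let $\mathbf{X}\sim\mathcal{N}(\mathbf{0}_n,\mathbf{I}_n)$. Then for every $i\in\{1,\dots,n\}$, $$\left|\mathbb{E}[X_{(i)}]-\Phi^{-1}\left(\frac{i}{n+1}\right)\right|\le\sqrt{\frac{\pi}{2}}\sqrt{\frac{2}{i}+\frac{2}{n+1-i}+\left|\frac1i-\frac{1}{2(n+1-i)}\right|^2},$$ and $$\left|\mathsf{Var}(\vec{\mathbf{X}})-\left(n-\sum_{i=1}^n\left(\Phi^{-1}\left(\frac{i}{n+1}\right)\right)^2\right)\right|\le 2\sqrt{18(n+1)\frac{3\pi}{2}\left(2\log(n)+\frac1n+1\right)}+\frac{3\pi}{2}\left(2\log(n)+\frac1n+1\right).$$
   Context: $\vec{\mathbf{X}}$ is $\mathbf{X}$ with entries sorted in ascending order and $X_{(i)}$ is its $i$-th entry (the $i$-th order statistic). $\mathsf{Var}(\vec{\mathbf{X}})=\mathbb{E}\left[\|\vec{\mathbf{X}}-\mathbb{E}[\vec{\mathbf{X}}]\|^2\right]$. $\Phi^{-1}$ is the quantile function (inverse CDF) of the standard normal distribution; $\log$ is the natural logarithm. *)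

(* Defs.v *)
From HB Require Import structures.
From mathcomp Require Import all_boot all_order all_algebra.
From mathcomp Require Import all_classical all_reals all_analysis.
Set Implicit Arguments. Unset Strict Implicit. Unset Printing Implicit Defensive.
Import Order.TTheory GRing.Theory Num.Theory.
Import numFieldNormedType.Exports.
Local Open Scope classical_set_scope.
Local Open Scope ring_scope.

Section gaussian_defs.
Context {R : realType}.

Definition stdnormal : set R -> \bar R := normal_prob (0 : R) 1.

(* E[f(X)] for X ~ N(0_n, I_n), i.e. X = (X_1,...,X_n) with i.i.d. N(0,1)
   coordinates, computed as the iterated integral against the product of the
   n standard normal laws (Fubini); f receives the list [:: X_1; ...; X_n]. *)
Fixpoint gaussE (n : nat) (f : seq R -> R) : R :=
  match n with
  | 0 => f [::]
  | n'.+1 => \int[stdnormal]_(x in [set: R]) gaussE n' (fun s => f (x :: s))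
  end.

Definition order_stat (i : nat) (s : seq R) : R :=
  nth 0 (sort <=%R s) i.-1.

Definition var_sorted (n : nat) : R :=
  gaussE n (fun s => \sum_(1 <= i < n.+1)
                        (order_stat i s - gaussE n (order_stat i)) ^+ 2).

Definition Phi (x : R) : R := fine (stdnormal `]-oo, x]).

Definition Phi_inv (p : R) : R := inf [set x : R | p <= Phi x].

End gaussian_defs.

(* Main.v *)
Require Import Defs.
From HB Require Import structures.
From mathcomp Require Import all_boot all_order all_algebra.
From mathcomp Require Import all_classical all_reals all_analysis.
From mathcomp Require Import measurable_realfun ring lra.
Set Implicit Arguments. Unset Strict Implicit. Unset Printing Implicit Defensive.
Import Order.TTheory GRing.Theory Num.Theory.
Import numFieldNormedType.Exports.
Local Open Scope ring_scope.

(* With p = i / (n + 1), q = Phi_inv p and j = n + 1 - i, the main estimate is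
   |E X_(i) - q|^2 <= (pi / 2) (2 / i + 2 / j).

   Mills' inequality Phi (1 - Phi) <= sqrt (pi / 2) phi makes the inverse of
   logit \o Phi a sqrt (pi / 2)-Lipschitz map, so |X_(i) - q| is at most
   sqrt (pi / 2) |ln t|, where t is the ratio of the odds of Phi X_(i) to the
   odds of p, and by AM-GM 2 |ln t| <= a (t + 1 / t - 2) + 1 / a for all a > 0.

   No density of order statistics is needed to integrate t and 1 / t.  If Y is
   independent of an (n-1)-sample Z, then
   E [Y >= Z_(i)] / (1 - Phi Z_(i)) = 1; summing over the n ways of singling
   out Y in an n-sample, the n - i largest points contribute
   1 / (1 - Phi X_(i)) each, hence E 1 / (1 - Phi X_(i)) <= n / (n - i), and
   symmetrically E 1 / Phi X_(i) <= n / (i - 1).  At the extremes i = 1 and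
   i = n, where one of these bounds is void, one side of the estimate comes
   from q - min X <= sum_k max 0 (q - X_k) instead.

   Finally Var = n - sum_i (E X_(i))^2, and the second bound follows from the
   first by Cauchy-Schwarz and the logarithmic bound on harmonic sums. *)

(** * The standard normal distribution *)

Section Gaussian.
Context {R : realType}.
Local Open Scope classical_set_scope.
Implicit Types x y p q : R.

Local Notation mu := (@lebesgue_measure R).
Local Notation gam := (@normal_prob R 0 1).
Local Notation phi := (@normal_pdf R 0 1).
Local Notation C := (Num.sqrt (pi / 2) : R).

Lemma PhiE x : (Phi x)%:E = gam `]-oo, x].
Proof. by rewrite /Phi /stdnormal fineK// fin_num_measure. Qed.

Lemma normal_prob_itvy x : gam `[x, +oo[ = (1 - Phi x)%:E.
Proof.
rewrite -setCitvl probability_setC// EFinB PhiE; congr (1 - _)%E.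
(* The half-lines []-oo, x[] and []-oo, x]] have the same mass because the law has a density. *)
apply: (@integral_itv_bndo_bndc R -oo%O x (fun t => (phi t)%:E)).
by apply: measurable_funTS; apply/measurable_EFinP; exact: measurable_normal_pdf.
Qed.

Lemma is_derive_Phi x : is_derive x 1 (@Phi R) (phi x).
Proof.
have := @continuous_FTC1 R phi -oo%O x (x + 1).
have xx : x < x + 1 by rewrite ltrDl.
have int1 : mu.-integrable `]-oo, x + 1] (EFin \o phi).
  by apply: integrableS (integrable_normal_pdf 0 1).
have cphi : {for x, continuous phi}.
  exact: (@continuous_normal_pdf R 0 1 (oner_neq0 R) x).
move=> /(_ xx int1 (ltNyr _) cphi)[d1 d2].
apply: DeriveDef; first exact: d1.
by rewrite -derive1E.
Qed.

Lemma stdnormal_pdf_gt0 x : 0 < phi x.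
Proof.
rewrite normal_pdfE ?oner_neq0// mulr_gt0 ?expR_gt0//.
by rewrite normal_peak_gt0 ?oner_neq0.
Qed.

Lemma stdnormal_pdfE x : phi x = (Num.sqrt (2 * pi))^-1 * expR (- x ^+ 2 / 2).
Proof.
rewrite normal_pdfE ?oner_neq0// /normal_peak /normal_fun.
by rewrite expr1n subr0 mul1r !mulr_natl.
Qed.

Lemma is_derive_stdnormal_pdf x : is_derive x 1 phi (- x * phi x).
Proof.
rewrite (_ : phi = (fun x => (Num.sqrt (2 * pi))^-1 * expR (- x ^+ 2 / 2))); last first.
  by apply/funext => y; rewrite stdnormal_pdfE.
apply: is_derive_eq; rewrite /GRing.scale/=.
(* [field] fails on the normed-module operations left by [is_derive_eq]; [H]
   restates the goal, up to conversion, in the field [R]. *)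
suff H (k e t : R) : k * (e * (- x ^+ 2 * (- t * 0) + 2^-1 * - (x * 1 + x * 1)))
    = - x * (k * e) by exact: H.
by field.
Qed.

Lemma Phi_lt x y : x < y -> Phi x < Phi y.
Proof.
move=> xy; apply: (@gtr0_derive1_incr _ _ x y) => //.
- by move=> z _; have [] := is_derive_Phi z.
- move=> z _; rewrite derive1E; have [_ ->] := is_derive_Phi z.
  exact: stdnormal_pdf_gt0.
- apply: derivable_within_continuous => z _.
  by have [] := is_derive_Phi z.
Qed.

Lemma Phi_ge0 x : 0 <= Phi x. Proof. by rewrite /Phi fine_ge0. Qed.

Lemma Phi_gt0 x : 0 < Phi x.
Proof. by apply: le_lt_trans (Phi_ge0 (x - 1)) (Phi_lt _); rewrite ltrBlDr ltrDl. Qed.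

Lemma Phi_lt1 x : Phi x < 1.
Proof.
have xx : x < x + 1 by rewrite ltrDl.
apply: lt_le_trans (Phi_lt xx) _.
by rewrite -lee_fin PhiE probability_le1.
Qed.

Lemma continuous_Phi : continuous (@Phi R).
Proof.
move=> x; apply: differentiable_continuous; apply/derivable1_diffP.
by have [] := is_derive_Phi x.
Qed.

(** Under the law [gam] the identity is a random variable with distribution function [Phi]; the
    limits of distribution functions at infinity thus apply to [Phi]. *)
Let idR : measurableTypeR R -> R := idfun.

#[local] HB.instance Definition _ :=
  @isMeasurableFun.Build _ _ _ _ idR (@measurable_id _ _ setT).

Lemma cvg_PhiNy : Phi x @[x --> -oo] --> (0 : R).
Proof.
have := @cvg_cdfNy0 _ _ R gam idR.
exact: fine_cvg.
Qed.

Lemma cvg_Phiy : Phi x @[x --> +oo] --> (1 : R).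
Proof.
have := @cvg_cdfy1 _ _ R gam idR.
exact: fine_cvg.
Qed.

Lemma stdnormal_pdfN x : phi (- x) = phi x.
Proof. by rewrite !stdnormal_pdfE sqrrN. Qed.

(** As [phi] is even, [Phi y + Phi (- y)] has zero derivative, hence is constant, and its limit at
    [+oo] is 1. *)
Lemma PhiN x : Phi (- x) = 1 - Phi x.
Proof.
pose g y := Phi y + Phi (- y) : R.
have dg y : is_derive y 1 g 0.
  have d1 := is_derive_Phi y.
  have d2 : is_derive y 1 (fun z => Phi (- z)) (phi (- y) * - 1).
    apply: (@is_derive1_comp _ (@Phi R) (fun z => - z)); exact: is_derive_Phi.
  apply: is_derive_eq.
  suff H (a : R) : a + a * - 1 = 0 by rewrite stdnormal_pdfN; exact: H.
  by ring.
have gc y : g y = g x by apply: is_derive_0_is_cst => z; exact: dg.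
have : g y @[y --> +oo] --> g x.
  rewrite (_ : g = cst (g x)); last by apply/funext.
  exact: cvg_cst.
have g1 : g y @[y --> +oo] --> (1 : R).
  rewrite -[X in _ --> X](addr0 1); apply: cvgD; first exact: cvg_Phiy.
  by have /cvgNy_compNP := cvg_PhiNy.
move=> g2; have e : 1 = g x :> R by exact: (cvg_unique (@Rhausdorff R) g1 g2).
by move: e; rewrite /g; lra.
Qed.

Lemma Phi0 : Phi 0 = 1 / 2 :> R.
Proof. have := PhiN 0; rewrite oppr0; lra. Qed.

Lemma Phi_le x y : x <= y -> Phi x <= Phi y.
Proof. by rewrite le_eqVlt => /predU1P[->//|/Phi_lt/ltW]. Qed.

Lemma Phi_surj p : 0 < p < 1 -> exists x, Phi x = p.
Proof.
move=> /andP[p0 p1].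
have [a pa] : exists a : R, Phi a < p.
  have := cvgr_lt _ cvg_PhiNy _ p0.
  by move=> /(_ _)/filter_ex[a ?]; exists a.
have [b pb] : exists b : R, p < Phi b.
  have := cvgr_gt _ cvg_Phiy _ p1.
  by move=> /(_ _)/filter_ex[b ?]; exists b.
have ab : a <= b.
  rewrite leNgt; apply/negP => /Phi_lt ba.
  by move: (lt_trans pb (lt_trans ba pa)); rewrite ltxx.
have [c _ <-] : exists2 c, c \in `[a, b]%R & Phi c = p.
  apply: IVT => //.
    by apply: continuous_subspaceT; exact: continuous_Phi.
  by rewrite ge_min le_max (ltW pa) (ltW pb) orbT.
by exists c.
Qed.

Lemma Phi_invK p : 0 < p < 1 -> Phi (Phi_inv p) = p.
Proof.
move=> /Phi_surj[x <-]; congr Phi; rewrite /Phi_inv.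
(* Strict monotonicity turns the set whose infimum defines [Phi_inv] into a closed half-line
   starting at [x]. *)
rewrite (_ : [set y : R | Phi x <= Phi y] = `[x, +oo[); first exact: inf_itv.
apply/seteqP; split => y /=; rewrite in_itv/= andbT; last exact: Phi_le.
by move=> xy; rewrite leNgt; apply/negP => /Phi_lt; rewrite ltNge xy.
Qed.

(** The constant [C] is the one for which [C * phi] and [Phi] agree at 0, where Mills' inequality
    becomes an equality. *)
Lemma sqrt_pi_half_pdf0 : C * phi 0 = 1 / 2.
Proof.
have pi0 := @pi_gt0 R.
rewrite stdnormal_pdfE expr0n/= oppr0 mul0r expR0 mulr1.
rewrite (_ : 2 * pi = 2 ^+ 2 * (pi / 2)); last by field.
rewrite (@sqrtrM _ (2 ^+ 2)) ?exprn_ge0// sqrtr_sqr ger0_norm//.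
have : C != 0 by rewrite gt_eqF// sqrtr_gt0 divr_gt0.
by move=> ?; field.
Qed.

Lemma sqrt_pi_half_gt0 : 0 < C. Proof. by rewrite sqrtr_gt0 divr_gt0 ?pi_gt0. Qed.

(* [C * phi - Phi] vanishes at [-oo] and at [0], increases up to [- 1 / C]
   and then decreases. *)
Lemma Phi_le_pdf x : x <= 0 -> Phi x <= C * phi x.
Proof.
move=> x0; pose D y := C * phi y - Phi y; rewrite -subr_ge0 -/(D x).
have C0 := sqrt_pi_half_gt0.
have dD y : is_derive y 1 D (phi y * (- (C * y) - 1)).
  have d1 := is_derive_Phi y.
  have d2 := is_derive_stdnormal_pdf y.
  apply: is_derive_eq.
  suff H (c k : R) : c * (- y * k) - k = k * (- (c * y) - 1) by exact: H.
  by ring.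
have D1 y : derivable D y 1 by have [] := dD y.
have D2 y : D^`() y = phi y * (- (C * y) - 1) by rewrite derive1E; have [_ ->] := dD y.
have [xC|xC] := leP x (- C^-1); last first.
  rewrite (_ : 0 = D 0); last by rewrite /D sqrt_pi_half_pdf0 Phi0 subrr.
  apply: (@ler0_derive1_nincr _ D x 0) => //.
  - move=> y; rewrite in_itv/= => /andP[xy _].
    rewrite D2 mulr_ge0_le0 ?normal_pdf_ge0// subr_le0.
    have := ltr_pM2l C0 (- C^-1) y; rewrite mulrN mulfV ?gt_eqF// (lt_trans xC xy).
    by move=> ?; lra.
  - by apply: derivable_within_continuous => z _.
(* If [D x < 0], some [y <= x] has [Phi y < - D x], hence [D y >= - Phi y > D x], although [D]
   increases up to [- 1 / C]. *)
rewrite leNgt; apply/negP => Dx.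
have e0 : 0 < - D x by rewrite oppr_gt0.
have := cvgr_lt _ cvg_PhiNy _ e0.
have lex : \forall y \near -oo, y <= x by exact: nbhs_ninfty_le (num_real x).
move=> /(_ _)/(filterI lex)/filter_ex[y [yx Py]].
have : D y <= D x.
  apply: (@ger0_derive1_ndecrNy _ D (- C^-1)) => //.
  - move=> z; rewrite in_itv/= => zC.
    rewrite D2 mulr_ge0 ?normal_pdf_ge0// subr_ge0.
    have := ltr_pM2l C0 z (- C^-1); rewrite mulrN mulfV ?gt_eqF// zC.
    by move=> ?; lra.
  - by apply: derivable_within_continuous => z _.
have := normal_pdf_ge0 (0 : R) 1 y.
move=> /(mulr_ge0 (ltW C0)); rewrite {1}/D.
move: Py; lra.
Qed.

Lemma onem_Phi_le_pdf x : 0 <= x -> 1 - Phi x <= C * phi x.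
Proof. by move=> x0; rewrite -PhiN -stdnormal_pdfN Phi_le_pdf// oppr_le0. Qed.

Definition logit_Phi x := ln (Phi x) - ln (1 - Phi x).

(** The derivative of [logit_Phi] is [phi / (Phi * (1 - Phi))], which Mills' inequality bounds below
    by [1 / C]. *)
Lemma logit_Phi_lipschitz x y : x <= y ->
  y - x <= C * (logit_Phi y - logit_Phi x).
Proof.
move=> xy; pose D y := C * logit_Phi y - y.
have C0 := sqrt_pi_half_gt0.
have dD (z : R) : is_derive z 1 D (C * (phi z / Phi z + phi z / (1 - Phi z)) - 1).
  have d1 := is_derive_Phi z.
  have P0 := Phi_gt0 z.
  have P1 : 0 < 1 - Phi z by rewrite subr_gt0 Phi_lt1.
  have d2 : is_derive z 1 (fun z => ln (Phi z)) ((Phi z)^-1 * phi z).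
    by apply: (@is_derive1_comp _ (@ln R) (@Phi R)); exact: is_derive1_ln.
  have d3 : is_derive z 1 (fun z => ln (1 - Phi z)) ((1 - Phi z)^-1 * (- phi z)).
    apply: (@is_derive1_comp _ (@ln R) (fun z => 1 - Phi z)).
      exact: is_derive1_ln.
    by apply: is_derive_eq; rewrite add0r mul1r.
  rewrite /D /logit_Phi; apply: is_derive_eq.
  suff H (c k a b : R) : c * (a * k - b * - k) - 1 = c * (k * a + k * b) - 1.
    exact: H.
  by ring.
suff : D x <= D y by rewrite /D; lra.
apply: (@ger0_derive1_ndecr _ D x y) => //.
- move=> z _; rewrite derive1E; have [_ ->] := dD z.
  have P0 := Phi_gt0 z.
  have P1 : 0 < 1 - Phi z by rewrite subr_gt0 Phi_lt1.
  (* On each side of 0 one factor is at most [C * phi z] and the other at most 1. *)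
  have Cp : Phi z * (1 - Phi z) <= C * phi z.
    have [z0|/ltW z0] := leP z 0.
      apply: le_trans (Phi_le_pdf z0); rewrite ler_piMr ?(ltW P0)//; lra.
    apply: le_trans (onem_Phi_le_pdf z0); rewrite ler_piMl ?(ltW P1)//.
    exact/ltW/Phi_lt1.
  rewrite subr_ge0 (_ : C * _ = C * phi z / (Phi z * (1 - Phi z))).
    by rewrite ler_pdivlMr ?mulr_gt0// mul1r.
  by field; rewrite !gt_eqF.
- by apply: derivable_within_continuous => z _; have [] := dD z.
Qed.

(** * Integration against the standard normal law *)

Lemma integral_stdnormal (f : R -> \bar R) : measurable_fun setT f ->
  (forall x, 0 <= f x)%E ->
  (\int[gam]_x f x = \int[mu]_x (f x * (phi x)%:E))%E.
Proof.
move=> mf f0; have dom := @normal_prob_dominates R 0 1.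
rewrite -(Radon_Nikodym_SigmaFinite.change_of_variables dom f0 measurableT mf).
have mphi : measurable_fun setT (fun x => (phi x)%:E).
  by apply/measurable_EFinP; exact: measurable_normal_pdf.
have ig := Radon_Nikodym_SigmaFinite.f_integrable dom.
apply: ae_eq_integral => //.
- by apply: emeasurable_funM => //; exact: measurable_int ig.
- exact: emeasurable_funM.
(* The Radon-Nikodym derivative of [gam] agrees almost everywhere with [phi], since both integrate
   to [gam E] over every measurable [E]. *)
- apply: ae_eqe_mul2l; apply: integral_ae_eq => //.
  by move=> E _ mE; rewrite -Radon_Nikodym_SigmaFinite.f_integral.
Qed.

Lemma fubini_section (A : set (R * R)) : measurable A ->
  (\int[gam]_x mu (xsection A x) = \int[mu]_t gam (ysection A t))%E.
Proof.
move=> mA; have := indic_fubini_tonelli gam mu mA.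
by rewrite indic_fubini_tonelli_FE// indic_fubini_tonelli_GE.
Qed.

Lemma measurable_Phi : measurable_fun setT (@Phi R).
Proof. by apply: continuous_measurable_fun => x; exact: continuous_Phi. Qed.

Lemma lebesgue_measure_itvcc_max x y : mu `[x, y] = (Num.max 0 (y - x))%:E.
Proof.
rewrite lebesgue_measure_itv/= lte_fin; case: ltP => xy.
  by rewrite max_r// subr_ge0 ltW.
by rewrite max_l// subr_le0.
Qed.

(** By Tonelli the left side is the integral over [t] in [J] of [gam (B t)]. Bounding this tail by
    [C * phi t] leaves [C] times the integral of the density over [J]. *)
Lemma stdnormal_le_tail (J : set R) (B : R -> set R) :
  measurable J -> measurable [set z : R * R | B z.2 z.1] ->
  (forall t, J t -> gam (B t) <= (C * phi t)%:E)%E ->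
  (\int[gam]_x mu (J `&` [set t | B t x]) <= C%:E * gam J)%E.
Proof.
move=> mJ mB BC; pose A := [set z : R * R | J z.2] `&` [set z : R * R | B z.2 z.1].
have mA : measurable A.
  apply: measurableI => //; rewrite -[X in measurable X]setTI.
  exact: measurable_snd.
have xA x : xsection A x = J `&` [set t | B t x] by rewrite xsectionE.
under eq_integral do rewrite -xA.
rewrite fubini_section//.
apply: (@le_trans _ _ (\int[mu]_(t in J) (C * phi t)%:E)%E).
  rewrite [leRHS]integral_mkcond; apply: ge0_le_integral => //=.
  - exact: measurable_fun_ysection.
  - apply/measurable_restrict => //; rewrite setTI; apply: measurable_funTS.
    apply/measurable_EFinP; apply: measurable_funM => //.
    exact: measurable_normal_pdf.
  - move=> t _; rewrite patchE ysectionE; case: ifPn => [/[!inE] Jt|/negP nJ].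
      apply: le_trans (BC _ Jt); apply: le_measure; rewrite ?inE//.
      + by have := measurable_ysection t mA; rewrite ysectionE.
      + by have := measurable_ysection t mB; rewrite ysectionE.
      + by move=> x [].
    rewrite [X in gam X](_ : _ = set0) ?measure0//.
    by apply/seteqP; split => x //= -[/mem_set].
under eq_integral do rewrite EFinM.
rewrite ge0_integralZl_EFin//; first last.
- by apply: measurable_funTS; apply/measurable_EFinP; exact: measurable_normal_pdf.
- by move=> t _; rewrite lee_fin normal_pdf_ge0.
Qed.

(** The integrand is the length of [[x, q]], the set of [t <= q] with [x <= t]; every such [t] is
    nonpositive, so [Phi_le_pdf] bounds the mass of []-oo, t]]. *)
Lemma stdnormal_lower_part q : q <= 0 ->
  (\int[gam]_x (Num.max 0 (q - x))%:E <= (C * Phi q)%:E)%E.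
Proof.
move=> q0; rewrite EFinM PhiE.
apply: le_trans (@stdnormal_le_tail `]-oo, q] (fun t => `]-oo, t]) _ _ _) => //.
- rewrite le_eqVlt; apply/orP; left; apply/eqP; apply: eq_integral => x _.
  rewrite -lebesgue_measure_itvcc_max; congr (mu _); apply/seteqP.
  split => t /=; rewrite !in_itv/=.
    by case/andP.
  by case=> -> ->.
- rewrite (_ : [set _ | _] = [set z : R * R | z.1 <= z.2]).
    by rewrite -[X in measurable X]setTI; apply: measurable_fun_le.
  by apply/seteqP; split => z /=; rewrite in_itv.
- move=> t /=; rewrite in_itv/= -PhiE lee_fin => tq.
  exact/Phi_le_pdf/(le_trans tq).
Qed.

Lemma stdnormal_upper_part q : 0 <= q ->
  (\int[gam]_x (Num.max 0 (x - q))%:E <= (C * (1 - Phi q))%:E)%E.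
Proof.
move=> q0; rewrite EFinM -normal_prob_itvy.
apply: le_trans (@stdnormal_le_tail `[q, +oo[ (fun t => `[t, +oo[) _ _ _) => //.
- rewrite le_eqVlt; apply/orP; left; apply/eqP; apply: eq_integral => x _.
  rewrite -lebesgue_measure_itvcc_max; congr (mu _); apply/seteqP.
  split => t /=; rewrite !in_itv/= !andbT.
    by case/andP.
  by case=> -> ->.
- rewrite (_ : [set _ | _] = [set z : R * R | z.2 <= z.1]).
    by rewrite -[X in measurable X]setTI; apply: measurable_fun_le.
  by apply/seteqP; split => z /=; rewrite in_itv/= andbT.
- move=> t /=; rewrite in_itv/= andbT normal_prob_itvy lee_fin => qt.
  exact/onem_Phi_le_pdf/(le_trans q0).
Qed.

(** From [expR (x ^+ 2 / 2) >= x ^+ 2 / 2] follows [x * phi x <= 2 * k / x], with [k] the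
    normalising constant. *)
Lemma cvg_mul_stdnormal_pdf : x * phi x @[x --> +oo] --> (0 : R).
Proof.
have k0 : 0 < (Num.sqrt (2 * pi))^-1 :> R.
  by rewrite invr_gt0 sqrtr_gt0 mulr_gt0// pi_gt0.
set k := _^-1 in k0.
apply: (@squeeze_cvgr _ _ _ _ (cst 0) (fun x => 2 * k * x^-1)).
- near=> x; have x0 : 0 < x by near: x; exact: nbhs_pinfty_gt.
  apply/andP; split; first by rewrite mulr_ge0 ?normal_pdf_ge0 ?ltW.
  rewrite stdnormal_pdfE -/k mulNr expRN -ler_pdivlMl//.
  rewrite (_ : x^-1 * (2 * k * x^-1) = k * (x ^+ 2 / 2)^-1); last first.
    by field; rewrite gt_eqF.
  have x2 : 0 < x ^+ 2 / 2 by rewrite divr_gt0// exprn_gt0.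
  rewrite ler_pM2l// lef_pV2 ?posrE ?expR_gt0//.
  by apply: le_trans (expR_ge1Dx _); rewrite lerDr.
- exact: cvg_cst.
- rewrite -(mulr0 (2 * k)); apply: cvgMr; apply/gtr0_cvgV0.
    exact: nbhs_pinfty_gt.
  exact: cvg_id.
Unshelve. all: by end_near. Qed.

Lemma stdnormal_second_moment : (\int[gam]_x (x ^+ 2)%:E = 1)%E.
Proof.
rewrite integral_stdnormal//; last 2 first.
- exact/measurable_EFinP.
- by move=> x; rewrite lee_fin sqr_ge0.
under eq_integral do rewrite -EFinM.
have phc : continuous phi by exact/continuous_normal_pdf/oner_neq0.
have cf : continuous (fun x : R => x ^+ 2 * phi x).
  move=> x; apply: cvgM; last exact: phc.
  exact: exprn_continuous.
rewrite ge0_symfun_integralT//; last 2 first.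
- by move=> x; rewrite mulr_ge0 ?sqr_ge0 ?normal_pdf_ge0.
- by move=> x; rewrite /= sqrrN stdnormal_pdfN.
(* By parity the integral is twice that over [[0, +oo[]. Integration by parts gives the
   antiderivative [Phi y - y * phi y], which goes from 1/2 at 0 to 1 at infinity. *)
have dF x : is_derive x 1 (fun y : R => Phi y - y * phi y) (x ^+ 2 * phi x).
  have d1 := is_derive_Phi x.
  have d2 := is_derive_stdnormal_pdf x.
  apply: is_derive_eq.
  suff H (k : R) : k - (x * (- x * k) + k * 1) = x ^+ 2 * k by exact: H.
  by ring.
rewrite (_ : [set x | _] = `[0, +oo[); last by rewrite set_itvE.
rewrite (@ge0_continuous_FTC2y _ _ (fun y : R => Phi y - y * phi y) 0 1).
- by rewrite mul0r subr0 Phi0 -EFinB -EFinM; congr EFin; field.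
- by move=> x _; rewrite mulr_ge0 ?sqr_ge0 ?normal_pdf_ge0.
- exact: continuous_subspaceT.
- rewrite -[X in _ --> X](subr0 1); apply: cvgB; first exact: cvg_Phiy.
  exact: cvg_mul_stdnormal_pdf.
- by move=> x _; have [] := dF x.
- apply: cvg_at_right_filter; apply: cvgB; first exact: continuous_Phi.
  by apply: cvgM; [exact: cvg_id|exact: phc].
- by move=> x _; rewrite derive1E; have [_ ->] := dF x.
Qed.
End Gaussian.

(** * Product law and leave-one-out sums *)

Section ProductLaw.
Context {R : realType}.
Local Open Scope classical_set_scope.

Local Notation RR := (measurableTypeR R).
Local Notation gam := (@normal_prob R 0 1).

Definition tuple_cons n (z : RR * n.-tuple RR) : n.+1.-tuple RR := [tuple of z.1 :: z.2].

Lemma measurable_tuple_cons n : measurable_fun setT (@tuple_cons n).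
Proof. exact: measurable_cons. Qed.

HB.instance Definition _ n :=
  isMeasurableFun.Build _ _ _ _ (@tuple_cons n) (@measurable_tuple_cons n).

(** The product law is pushed forward along [tuple_cons] one coordinate at a time, in the order in
    which [gaussE] integrates, so that the two can be compared by induction. *)
Fixpoint stdnormal_tuple n : probability (n.-tuple RR) R :=
  match n with
  | 0 => [the probability _ _ of \d_ [tuple]]
  | m.+1 => [the probability _ _ of
      distribution [the probability _ _ of (gam \x stdnormal_tuple m)%E]
                   [the {mfun _ >-> _} of @tuple_cons m]]
  end.

Local Notation P := stdnormal_tuple.

Lemma ge0_integral_stdnormal_tupleS n (f : n.+1.-tuple RR -> \bar R) :
  measurable_fun setT f -> (forall s, 0 <= f s)%E ->
  (\int[P n.+1]_s f s = \int[gam]_x \int[P n]_s f [tuple of x :: s])%E.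
Proof.
move=> mf f0; rewrite /= ge0_integral_distribution// fubini_tonelli1//=.
- exact: measurableT_comp.
Qed.

Lemma integral_stdnormal_tupleS n (f : n.+1.-tuple RR -> \bar R) :
  (P n.+1).-integrable setT f ->
  (\int[P n.+1]_s f s = \int[gam]_x \int[P n]_s f [tuple of x :: s])%E.
Proof.
move=> intf; have mf := measurable_int _ intf.
have intf' : (gam \x P n)%E.-integrable setT (f \o @tuple_cons n).
  apply/integrableP; split; first exact: measurableT_comp.
  case/integrableP : intf => _; rewrite /= ge0_integral_distribution//.
  exact: measurableT_comp.
by rewrite /= integral_distribution// -integral12_prod_meas1.
Qed.

(* [leave_one_out F l [:: y1; ..; yn]] is the sum over [k] of [F yk] at the
   list [l ++ [:: y1; ..; yn]] with [yk] removed, up to permutation. *)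
Fixpoint leave_one_out (F : R -> seq R -> \bar R) (l s : seq R) : \bar R :=
  if s is y :: s' then (F y (l ++ s') + leave_one_out F (y :: l) s')%E else 0%E.

Lemma measurable_cat_tuple d (Z : measurableType d) m n
    (l : Z -> m.-tuple RR) (s : Z -> n.-tuple RR) :
  measurable_fun setT l -> measurable_fun setT s ->
  measurable_fun setT (fun z => [tuple of l z ++ s z]).
Proof.
elim: m => [|m IH] in l *.
  move=> _ ms; rewrite (_ : (fun _ => _) = s)//.
  by apply/funext => z; apply/val_inj; rewrite /= tuple0.
move=> ml ms.
have ml' : measurable_fun setT (fun z => [tuple of behead (l z)] : m.-tuple RR).
  exact: (measurableT_comp (@measurable_behead _ _ m)).
have mh : measurable_fun setT (fun z => tnth (l z) ord0).
  exact: (measurableT_comp (@measurable_tnth _ _ _ _)).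
have := measurable_cons mh (IH _ ml' ms).
congr (measurable_fun _ _); apply/funext => z; apply/val_inj => /=.
by rewrite [in RHS](tuple_eta (l z)).
Qed.

Section leave_one_out.
Variable F : R -> seq R -> \bar R.
Hypothesis F0 : forall x s, (0 <= F x s)%E.
Hypothesis mF : forall k, measurable_fun setT (fun z : RR * k.-tuple RR => F z.1 z.2).

Lemma leave_one_out_ge0 l s : (0 <= leave_one_out F l s)%E.
Proof. by elim: s l => //= y s IH l; rewrite adde_ge0. Qed.

Lemma mF_comp d (Z : measurableType d) k (x : Z -> RR) (t : Z -> k.-tuple RR) :
  measurable_fun setT x -> measurable_fun setT t ->
  measurable_fun setT (fun z => F (x z) (t z)).
Proof.
move=> mx mt; pose g z := (x z, t z).
pose f (u : RR * k.-tuple RR) := F u.1 u.2.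
have mg : measurable_fun setT g by exact: measurable_fun_pair.
have mf : measurable_fun setT f by exact: mF.
by have : measurable_fun setT (f \o g) by exact: measurableT_comp.
Qed.

Lemma measurable_leave_one_out d (Z : measurableType d) m n
    (l : Z -> m.-tuple RR) (s : Z -> n.-tuple RR) :
  measurable_fun setT l -> measurable_fun setT s ->
  measurable_fun setT (fun z => leave_one_out F (l z) (s z)).
Proof.
elim: n => [|n IH] in m l s *.
  move=> _ _; rewrite (_ : (fun _ => _) = cst 0%E)//.
  by apply/funext => z; rewrite tuple0.
move=> ml ms.
have ms' : measurable_fun setT (fun z => [tuple of behead (s z)] : n.-tuple RR).
  exact: (measurableT_comp (@measurable_behead _ _ n)).
have mh : measurable_fun setT (fun z => tnth (s z) ord0).
  exact: (measurableT_comp (@measurable_tnth _ _ _ _)).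
have m1 := IH _ _ _ (measurable_cons mh ml) ms'.
have m2 := mF_comp mh (measurable_cat_tuple ml ms').
have := emeasurable_funD m2 m1.
congr (measurable_fun _ _); apply/funext => z /=.
by rewrite [in RHS](tuple_eta (s z)).
Qed.

(** Induction on the sample size. Singling out the first point [x] contributes [c]: Tonelli moves
    the integral over [x] inside, where the other points are fixed. The remaining terms form the sum
    for [x :: l] over a shorter sample, whose mean does not depend on [x]. *)
Lemma integral_leave_one_out (c : R) n l :
  (forall s, \int[gam]_x F x s = c%:E)%E ->
  (\int[P n]_s leave_one_out F l s = (n%:R * c)%:E)%E.
Proof.
move=> Fc; elim: n => [|n IH] in l *.
  by rewrite mul0r integral0_eq// => s _; rewrite tuple0.
have mloo m (k : m.-tuple RR) p : measurable_fun setT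
    (fun s : p.-tuple RR => leave_one_out F k s).
  exact: measurable_leave_one_out.
rewrite ge0_integral_stdnormal_tupleS//=; last 2 first.
- exact: (mloo _ (in_tuple l)).
- by move=> s; exact: leave_one_out_ge0.
have mFl : measurable_fun setT (fun z : RR * n.-tuple RR => F z.1 (l ++ z.2)).
  have mt : measurable_fun setT
      (fun z : RR * n.-tuple RR => [tuple of in_tuple l ++ z.2]).
    exact: (measurable_cat_tuple (measurable_cst (in_tuple l)) measurable_snd).
  exact: (mF_comp measurable_fst mt).
have nc0 : (0 <= (n%:R * c)%:E)%E.
  by rewrite -(IH [::]); apply: integral_ge0 => s _; exact: leave_one_out_ge0.
under eq_integral => x _.
  rewrite ge0_integralD//; first last.
  - exact: (mloo _ [tuple of x :: in_tuple l]).
  - by move=> s _; exact: leave_one_out_ge0.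
  - exact: (measurableT_comp mFl (measurable_pair1 x)).
  rewrite IH; over.
rewrite ge0_integralD//; first last.
- exact: (measurable_fun_fubini_tonelli_F _ mFl).
- by move=> x _; exact: integral_ge0.
rewrite integral_cst// [X in (_ + _ * X)%E]probability_setT mule1.
rewrite (fubini_tonelli _ mFl)//.
under eq_integral do rewrite /= Fc.
rewrite integral_cst// [X in (_ * X + _)%E]probability_setT mule1.
by rewrite -EFinD -natr1 mulrDl mul1r addrC.
Qed.
End leave_one_out.

End ProductLaw.

(** * Order statistics *)

Section OrderStat.
Context {R : realType}.
Local Open Scope classical_set_scope.
Local Notation RR := (measurableTypeR R).
Implicit Types (s t : seq R) (i : nat).

Lemma perm_order_stat i s t : perm_eq s t -> order_stat i s = order_stat i t.
Proof.
by move=> /perm_sort_leP st; rewrite /order_stat st.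
Qed.

Lemma order_stat_sorted i s : sorted <=%R s -> order_stat i s = nth 0 s i.-1.
Proof. by move=> /(sorted_sort le_trans) ss; rewrite /order_stat ss. Qed.

Lemma sum_order_stat (V : nmodType) (g : R -> V) s :
  \sum_(1 <= i < (size s).+1) g (order_stat i s) = \sum_(x <- s) g x.
Proof.
rewrite big_add1/= /order_stat -(perm_big _ (permEl (perm_sort <=%R s)))/=.
by rewrite [RHS](big_nth 0) size_sort.
Qed.

Lemma mem_order_stat i s : (1 <= i <= size s)%N -> order_stat i s \in s.
Proof.
move=> /andP[i1 is_]; rewrite -(mem_sort <=%R) mem_nth// size_sort.
by rewrite prednK.
Qed.

Lemma le_sum_mem (g : R -> R) s x : (forall y, 0 <= g y) -> x \in s ->
  g x <= \sum_(y <- s) g y.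
Proof.
move=> g0 xs; rewrite (perm_big _ (perm_to_rem xs)) big_cons lerDl.
exact: sumr_ge0.
Qed.

Lemma lt_nth_sorted t j (x : R) : sorted <=%R t -> (j < size t)%N ->
  (x < nth 0 t j) = (count (fun y : R => (y <= x)%R) t <= j)%N.
Proof.
elim: t j => //= y t IH j pt.
have st := path_sorted pt.
have yt : {in t, forall z, y <= z} by apply/allP; exact: order_path_min le_trans pt.
case: j => [_|j jt] /=.
  rewrite ltNge leqn0 addn_eq0 eqb0; case: (leP y x) => //= xy.
  apply/esym; rewrite eqn0Ngt -has_count; apply/hasPn => z zt.
  by rewrite -ltNge (lt_le_trans xy)// yt.
rewrite IH//; have [yx|xy] := leP y x; first by rewrite add1n.
rewrite add0n; have -> : count (fun y : R => y <= x) t = 0%N.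
  apply/eqP; rewrite eqn0Ngt -has_count; apply/hasPn => z zt.
  by rewrite -ltNge (lt_le_trans xy)// yt.
by [].
Qed.

(** The event that [order_stat i s] exceeds [x] says that at most [i - 1] entries are [<= x], a
    condition on a sum of indicators. *)
Lemma measurable_order_stat n i :
  measurable_fun setT (fun s : n.-tuple RR => order_stat i s : R).
Proof.
(* Out of range, [nth] returns its default value and the function is constantly 0. *)
have [ni|ni] := leqP n i.-1.
  rewrite (_ : (fun _ => _) = cst 0)//; apply/funext => s.
  by rewrite /order_stat nth_default// size_sort size_tuple.
apply: (measurability _ (@RGenOInfty.measurableE R)) => //.
move=> _ [_ [x ->] <-].
pose h (s : n.-tuple RR) : R := \sum_(j < n) \1_`]-oo, x] (tnth s j).
have mh : measurable_fun setT h.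
  apply: measurable_sum => j.
  apply: (measurableT_comp (measurable_indic _)) => //.
  exact: measurable_tnth.
rewrite [X in measurable X](_ : _ = setT `&` h @^-1` `]-oo, (i.-1)%:R]).
  exact: mh.
rewrite !setTI; apply/seteqP; split => s /=; rewrite !in_itv/= andbT /order_stat.
all: rewrite lt_nth_sorted ?sort_le_sorted ?size_sort ?size_tuple//.
all: rewrite (permP (permEl (perm_sort <=%R _))).
all: have -> : h s = (count (fun y : R => y <= x) s)%:R.
1,3: rewrite /h -sum1_count natr_sum big_tuple [RHS]big_mkcond.
1,2: by apply: eq_bigr => j _; rewrite indicE mem_setE in_itv/=; case: (_ <= _).
all: by rewrite ler_nat.
Qed.

Lemma perm_rem (T : eqType) (x : T) (a b : seq T) :
  x \in a -> perm_eq a b -> perm_eq (rem x a) (rem x b).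
Proof.
move=> xa ab; have xb : x \in b by rewrite -(perm_mem ab).
by rewrite -(perm_cons x) -(permPl (perm_to_rem xa)) -(permPr (perm_to_rem xb)).
Qed.

Section leave_one_out_perm.
Variable F : R -> seq R -> \bar R.
Hypothesis Fperm : forall x s t, perm_eq s t -> F x s = F x t.

Lemma leave_one_outE l s :
  (leave_one_out F l s = \sum_(x <- s) F x (rem x (l ++ s)))%E.
Proof.
elim: s l => [|y s IH] l /=; first by rewrite big_nil.
rewrite big_cons IH; congr (_ + _)%E.
  apply: Fperm; rewrite -(perm_cons y).
  have yl : y \in l ++ y :: s by rewrite mem_cat mem_head orbT.
  by rewrite -(permPr (perm_to_rem yl)) perm_sym perm_catC/= perm_cons perm_catC.
rewrite !big_seq; apply: eq_bigr => x xs; apply: Fperm.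
apply: perm_rem; first by rewrite inE mem_cat xs !orbT.
by rewrite perm_sym perm_catC/= perm_cons perm_catC.
Qed.

(** By symmetry of [F] in the remaining points, the removed point can run through the sorted sample;
    what remains is then sorted too, and its order statistics can be read off. *)
Lemma leave_one_out_sorted s (u := sort <=%R s) :
  (leave_one_out F [::] s =
   \sum_(j < size s) F (nth 0%R u j) (take j u ++ drop j.+1 u))%E.
Proof.
rewrite leave_one_outE/=.
transitivity (\sum_(x <- u) F x (rem x u))%E.
  rewrite (perm_big u) ?perm_sort//=; last by rewrite perm_sym perm_sort.
  rewrite !big_seq; apply: eq_bigr => x xs; apply: Fperm; apply: perm_rem.
    by rewrite -(mem_sort <=%R).
  by rewrite perm_sym perm_sort.
rewrite (big_nth 0) big_mkord size_sort; apply: eq_bigr => j _; apply: Fperm.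
have ju : (j < size u)%N by rewrite size_sort.
rewrite -(perm_cons (nth 0 u j)) -(permPl (perm_to_rem (mem_nth _ ju))).
rewrite -[X in perm_eq X _](cat_take_drop j u) (drop_nth 0 ju).
exact: (permEl (perm_catCA _ [:: _] _)).
Qed.
End leave_one_out_perm.

(** Positions count from 0, so the i-th order statistic sits at [i - 1]; deleting position [j] moves
    an entry down exactly when it lies after [j]. *)
Lemma order_stat_leave_one_out i s j (u := sort <=%R s) : (0 < i)%N ->
  (j < size s)%N ->
  order_stat i (take j u ++ drop j.+1 u) =
  if (j < i)%N then order_stat i.+1 s else order_stat i s.
Proof.
move=> i0 js; have su : size u = size s by rewrite size_sort.
rewrite order_stat_sorted; last first.
  apply: (subseq_sorted le_trans _ (sort_le_sorted s)).
  rewrite -[X in subseq _ X](cat_take_drop j) -/u cat_subseq// .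
  by rewrite [X in subseq _ X](drop_nth 0) ?su// subseq_cons.
have sj : size (take j u) = j by rewrite size_takel// su ltnW.
rewrite nth_cat sj /order_stat -/u /=.
have -> : (i.-1 < j)%N = ~~ (j < i)%N by rewrite prednK// -leqNgt.
case: ltnP => ij /=; last by rewrite nth_take// prednK.
rewrite nth_drop; congr (nth _ _ _).
by rewrite addSn -[in RHS](prednK i0) subnKC// -ltnS prednK.
Qed.

End OrderStat.

(** * Pointwise comparison with a quantile *)

Section Pointwise.
Context {R : realType}.
Implicit Types x y p q a : R.
Local Notation C := (Num.sqrt (pi / 2) : R).

Lemma sinh_ge y : 0 <= y -> 2 * y <= expR y - expR (- y).
Proof.
move=> y0; pose D z : R := expR z - expR (- z) - 2 * z.
have dD (z : R) : is_derive z 1 D (expR z + expR (- z) - 2).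
  rewrite /D; apply: is_derive_eq.
  suff H (e f : R) : e - f * - 1 - 2 * 1 = e + f - 2 by exact: H.
  by ring.
suff : D 0 <= D y by rewrite /D oppr0; lra.
apply: (@ger0_derive1_ndecr _ D 0 y) => //.
- move=> z _; rewrite derive1E; have [_ ->] := dD z.
  rewrite expRN; have e0 := expR_gt0 z.
  rewrite (_ : _ - 2 = (expR z - 1) ^+ 2 / expR z); last by field; rewrite gt_eqF.
  by rewrite divr_ge0 ?sqr_ge0 ?ltW.
- by apply: derivable_within_continuous => z _; have [] := dD z.
Qed.

(* AM-GM applied to [|y| <= |expR (y / 2) - expR (- y / 2)|]. *)
Lemma normr_le_expR y a : 0 < a ->
  `|y| <= (a * (expR y + expR (- y) - 2) + a^-1) / 2.
Proof.
wlog y0 : y / 0 <= y => [H a0|a0].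
  have [|/ltW y0] := leP 0 y; first by move=> /H; exact.
  have := H (- y); rewrite oppr_ge0 => /(_ y0 a0).
  by rewrite normrN opprK (addrC (expR (- y))).
rewrite ger0_norm//; have y2 : 0 <= y / 2 by rewrite divr_ge0.
have := sinh_ge y2; set e := expR (y / 2); set f := expR (- (y / 2)) => s.
have ef : e * f = 1 by rewrite /e /f -expRD subrr expR0.
have -> : expR y = e ^+ 2 by rewrite /e -expRM_natl; congr expR; field.
have -> : expR (- y) = f ^+ 2 by rewrite /f -expRM_natl; congr expR; field.
have -> : e ^+ 2 + f ^+ 2 - 2 = (e - f) ^+ 2.
  by rewrite sqrrB ef; ring.
have s1 : y <= e - f by lra.
apply: (le_trans s1); rewrite -subr_ge0.
rewrite (_ : _ - _ = a * (e - f - a^-1) ^+ 2 / 2); last by field; rewrite gt_eqF.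
by rewrite divr_ge0// mulr_ge0 ?sqr_ge0// ltW.
Qed.

(** Combines [y <= expR (y - 1)] with [2 <= expR 1]. *)
Lemma le_expR_half y : 0 <= y -> y <= expR y / 2.
Proof.
move=> y0; have := expR_ge1Dx (y - 1); rewrite addrC subrK => h.
have e2 : 2 <= expR 1 :> R by have := expR_ge1Dx (1 : R); lra.
by rewrite ler_pdivlMr// -[in leRHS](subrK 1 y) expRD ler_pM.
Qed.

(** In this form the odds are affine in [1 / (1 - Phi x)], the weight whose mean the leave-one-out
    argument controls. *)
Lemma expR_logit_Phi x : expR (logit_Phi x) = (1 - Phi x)^-1 - 1.
Proof.
have P0 := Phi_gt0 x; have P1 : 0 < 1 - Phi x by rewrite subr_gt0 Phi_lt1.
rewrite /logit_Phi expRB !lnK ?posrE//; field; rewrite gt_eqF//.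
Qed.

Lemma expR_logit_PhiN x : expR (- logit_Phi x) = (Phi x)^-1 - 1.
Proof.
have P0 := Phi_gt0 x; have P1 : 0 < 1 - Phi x by rewrite subr_gt0 Phi_lt1.
rewrite /logit_Phi opprB expRB !lnK ?posrE//; field; rewrite gt_eqF//.
Qed.

Lemma logit_Phi_le x y : x <= y -> logit_Phi x <= logit_Phi y.
Proof.
move=> xy; have := logit_Phi_lipschitz xy; have C0 := @sqrt_pi_half_gt0 R => h.
rewrite -subr_ge0 -(pmulr_rge0 _ C0); apply: le_trans h.
by rewrite subr_ge0.
Qed.

Lemma dist_logit_Phi x q : `|x - q| <= C * `|logit_Phi x - logit_Phi q|.
Proof.
wlog qx : x q / q <= x => [H|].
  have [/H//|/ltW /H] := leP q x.
  by rewrite distrC (distrC (logit_Phi q)).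
rewrite !ger0_norm ?subr_ge0 ?logit_Phi_le//; exact: logit_Phi_lipschitz.
Qed.

(** Since [r] is the inverse of the odds of [Phi q], the two products are the ratio [t] of odds and
    [1 / t]. The parameter [a] stays free, to be balanced after integration. *)
Lemma dist_le_odds x q a (r := (1 - Phi q) / Phi q) : 0 < a ->
  `|x - q| <= C / 2 * (a * (((1 - Phi x)^-1 - 1) * r + ((Phi x)^-1 - 1) / r - 2)
                      + a^-1).
Proof.
move=> a0; apply: le_trans (dist_logit_Phi x q) _.
rewrite -mulrA ler_pM2l ?sqrt_pi_half_gt0// mulrC.
apply: le_trans (normr_le_expR _ a0) _.
have P0 := Phi_gt0 q; have P1 : 0 < 1 - Phi q by rewrite subr_gt0 Phi_lt1.
have E y z : expR (logit_Phi y - logit_Phi z) =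
    ((1 - Phi y)^-1 - 1) * ((Phi z)^-1 - 1) :> R.
  by rewrite expRD expR_logit_Phi expR_logit_PhiN.
rewrite (opprB (logit_Phi x)) !E (mulrC ((1 - Phi q)^-1 - 1)) /r.
rewrite le_eqVlt; apply/orP; left; apply/eqP; congr (_ / 2).
congr (a * _ + _); congr (_ + _ - _); congr (_ * _); field; rewrite ?gt_eqF//.
Qed.

(** A one-sided estimate in [t] alone, for the minimum of the sample, where the bound on the mean of
    [1 / Phi] is void. Here [le_expR_half] replaces AM-GM. *)
Lemma sub_le_odds x q :
  x - q <= C / 2 * (((1 - Phi x)^-1 - 1) * ((1 - Phi q) / Phi q)).
Proof.
have C0 := @sqrt_pi_half_gt0 R.
have P0 := Phi_gt0 q; have P1 : 0 < 1 - Phi q by rewrite subr_gt0 Phi_lt1.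
have -> : ((1 - Phi x)^-1 - 1) * ((1 - Phi q) / Phi q) =
    expR (logit_Phi x - logit_Phi q).
  rewrite expRD expR_logit_Phi expR_logit_PhiN; congr (_ * _); field.
  by rewrite gt_eqF.
have [xq|/ltW qx] := leP x q.
  apply: (@le_trans _ _ 0); first by rewrite subr_le0.
  by rewrite mulr_ge0 ?expR_ge0 ?divr_ge0// ltW.
apply: le_trans (logit_Phi_lipschitz qx) _.
rewrite -mulrA ler_pM2l// mulrC le_expR_half// subr_ge0.
exact: logit_Phi_le.
Qed.

(** The reflection [x |-> - x] exchanges [Phi] and [1 - Phi], which reduces this to
    [sub_le_odds]. *)
Lemma sub_ge_odds x q :
  q - x <= C / 2 * (((Phi x)^-1 - 1) * (Phi q / (1 - Phi q))).
Proof.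
have := sub_le_odds (- x) (- q); rewrite !PhiN; set a := C / 2 => h.
have P0 := Phi_gt0 x; have P1 : 0 < 1 - Phi q by rewrite subr_gt0 Phi_lt1.
apply: le_trans (le_trans _ h) _; first by rewrite opprK addrC.
have e (z : R) : 1 - (1 - z) = z by ring.
by rewrite !e.
Qed.

End Pointwise.

(** * Expectations *)

Section Expectation.
Context {R : realType}.
Local Open Scope classical_set_scope.
Local Notation RR := (measurableTypeR R).
Local Notation gam := (@normal_prob R 0 1).
Local Notation P := (@stdnormal_tuple R).

Lemma measurable_inv_gt0 (b : R -> R) : measurable_fun setT b ->
  (forall a, 0 < b a) -> measurable_fun setT (fun a => (b a)^-1).
Proof.
move=> mb b0; rewrite (_ : (fun _ => _) = (fun a => expR (- ln (b a)))).
  apply: (measurableT_comp (@measurable_expR R)).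
  apply: measurableT_comp; first exact: oppr_measurable.
  exact: (measurableT_comp (@measurable_ln R)).
by apply/funext => a; rewrite expRN lnK// posrE.
Qed.

(** The function [F x t], the indicator of [x] in [B (order_stat i t)] divided by its probability,
    has mean 1 in [x], so its leave-one-out sum has mean [n]. Each removed position in [J]
    contributes [1 / b (order_stat k s)]; the other terms are nonnegative and are dropped. *)
Lemma integral_inv_tail_le n i k (J : pred nat) (B : R -> set R) (b : R -> R) :
  measurable [set z : RR * RR | B z.2 z.1] -> measurable_fun setT b ->
  (forall a, 0 < b a) -> (forall a, gam (B a) = (b a)%:E) ->
  (forall s j, size s = n -> (j < n)%N -> J j ->
    let u := sort <=%R s in
    order_stat i (take j u ++ drop j.+1 u) = order_stat k s /\
    B (order_stat k s) (nth 0 u j)) ->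
  ((\sum_(j < n | J j) 1)%:R%:E * \int[P n]_s ((b (order_stat k s))^-1)%:E
    <= n%:R%:E)%E.
Proof.
move=> mB mb b0 gB H.
pose F (x : R) (t : seq R) : \bar R :=
  (\1_(B (order_stat i t)) x * (b (order_stat i t))^-1)%:E.
have F0 x t : (0 <= F x t)%E.
  by rewrite lee_fin mulr_ge0// invr_ge0 ltW.
have Fperm x s t : perm_eq s t -> F x s = F x t.
  by move=> /(perm_order_stat i) st; rewrite /F st.
have mbV := measurable_inv_gt0 mb b0.
have mF m : measurable_fun setT (fun z : RR * m.-tuple RR => F z.1 z.2).
  apply/measurable_EFinP; apply: measurable_funM; last first.
    apply: (measurableT_comp mbV).
    exact: (measurableT_comp (@measurable_order_stat R m i)).
  pose g (z : RR * m.-tuple RR) : RR * RR := (z.1, order_stat i z.2).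
  have mg : measurable_fun setT g.
    apply: measurable_fun_pair => //.
    exact: (measurableT_comp (@measurable_order_stat R m i)).
  have mI : measurable_fun setT (\1_[set z : RR * RR | B z.2 z.1] : _ -> R).
    exact: measurable_indic.
  have := measurableT_comp mI mg.
  by congr (measurable_fun _ _); apply/funext => z; rewrite /= !indicE.
have F1 t : (\int[gam]_x F x t = 1)%E.
  have mBt : measurable (B (order_stat i t)).
    have := measurable_ysection (order_stat i t) mB.
    by rewrite ysectionE.
  rewrite /F; under eq_integral do rewrite mulrC EFinM.
  rewrite ge0_integralZl_EFin//; last 2 first.
  - by apply/measurable_EFinP; exact: measurable_indic.
  - by rewrite invr_ge0 ltW.
  rewrite [X in (_ * X)%E](_ : _ = gam (B (order_stat i t))); last first.
    by rewrite integral_indic// setIT.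
  by rewrite gB -EFinM mulVf// gt_eqF// b0.
have := integral_leave_one_out F0 mF n [::] F1.
rewrite mulr1 => <-.
rewrite -ge0_integralZl_EFin//; last 2 first.
- by move=> s _; rewrite lee_fin invr_ge0 ltW.
- apply/measurable_EFinP; apply: (measurableT_comp mbV).
  exact: measurable_order_stat.
apply: ge0_le_integral => //.
- by move=> s _; rewrite -EFinM lee_fin mulr_ge0// invr_ge0 ltW.
- apply/measurable_EFinP; apply: measurable_funM => //.
  apply: (measurableT_comp mbV); exact: measurable_order_stat.
- have ml : measurable_fun setT (fun _ : n.-tuple RR => [tuple] : 0.-tuple RR).
    exact: measurable_cst.
  exact: (measurable_leave_one_out mF ml (@measurable_id _ _ _)).
move=> s _; rewrite (leave_one_out_sorted Fperm) size_tuple.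
rewrite [leRHS](bigID (fun j : 'I_n => J j))/= -[leLHS]adde0.
apply: leeD; last by apply: sume_ge0.
rewrite (eq_bigr (fun=> ((b (order_stat k s))^-1)%:E)); last first.
  move=> j Jj; have [e Be] := H s j (size_tuple s) (ltn_ord j) Jj.
  rewrite /F e indicE mem_set ?mul1r//.
by rewrite sumEFin -EFinM lee_fin natr_sum mulr_suml ler_sum// => j _; rewrite mul1r.
Qed.

(** Removing one of the [n - i] points at positions [j >= i] does not change the i-th order
    statistic, and the removed point lies above it. *)
Lemma integral_inv_upper n i : (1 <= i < n)%N ->
  (\int[P n]_s ((1 - Phi (order_stat i s))^-1)%:E <= (n%:R / (n - i)%:R)%:E)%E.
Proof.
move=> /andP[i1 ni].
have ni0 : 0 < (n - i)%:R :> R by rewrite ltr0n subn_gt0.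
have := @integral_inv_tail_le n i i (fun j => i <= j)%N (fun a => `[a, +oo[)
  (fun a => 1 - Phi a).
have -> : (\sum_(j < n | (i <= j)%N) 1)%:R = (n - i)%:R :> R.
  by rewrite -(big_geq_mkord _ _ xpredT (fun=> 1%N)) sum_nat_const_nat muln1.
move=> h; rewrite EFinM lee_pdivlMr// muleC; apply: h.
- rewrite (_ : [set _ | _] = [set z : R * R | z.2 <= z.1]).
    by rewrite -[X in measurable X]setTI; apply: measurable_fun_le.
  by apply/seteqP; split => z /=; rewrite in_itv/= andbT.
- apply: measurable_funB => //.
  exact: measurable_Phi.
- by move=> a; rewrite subr_gt0 Phi_lt1.
- by move=> a; exact: normal_prob_itvy.
move=> s j sn jn ij u; split.
  rewrite order_stat_leave_one_out ?sn// ifF//.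
  by apply/negbTE; rewrite -leqNgt.
rewrite /= in_itv/= andbT /order_stat.
apply: (sorted_leq_nth le_trans le_refl) => //; first exact: sort_le_sorted.
- by rewrite inE size_sort sn (leq_ltn_trans _ ni)// leq_pred.
- by rewrite inE size_sort sn.
- by rewrite (leq_trans (leq_pred _)).
Qed.

(** Removing one of the [i - 1] smallest points shifts the indices: the order statistic of rank
    [i - 1] among the others is the one of rank [i] in the full sample. Hence the ranks [k.+1] and
    [k.+2] below. *)
Lemma integral_inv_lower n i : (1 < i <= n)%N ->
  (\int[P n]_s ((Phi (order_stat i s))^-1)%:E <= (n%:R / (i.-1)%:R)%:E)%E.
Proof.
case: i => [|[|k]]// /andP[_ kn].
have := @integral_inv_tail_le n k.+1 k.+2 (fun j => j < k.+1)%N (fun a => `]-oo, a])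
  (@Phi R).
have -> : (\sum_(j < n | (j < k.+1)%N) 1)%:R = k.+1%:R :> R.
  congr (_%:R); rewrite -(big_ord_widen _ (fun=> 1%N)) ?(ltnW kn)//.
  by rewrite sum_nat_const card_ord muln1.
move=> h; rewrite EFinM lee_pdivlMr// muleC; apply: h.
- rewrite (_ : [set _ | _] = [set z : R * R | z.1 <= z.2]).
    by rewrite -[X in measurable X]setTI; apply: measurable_fun_le.
  by apply/seteqP; split => z /=; rewrite in_itv.
- exact: measurable_Phi.
- exact: Phi_gt0.
- by move=> a; rewrite PhiE.
move=> s j sn jn jk u; split.
  by rewrite order_stat_leave_one_out ?sn// jk.
rewrite /= in_itv/= /order_stat/=.
apply: (sorted_leq_nth le_trans le_refl) => //; first exact: sort_le_sorted.
- by rewrite inE size_sort sn.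
- by rewrite inE size_sort sn.
- exact: ltnW.
Qed.

End Expectation.

(** * The iterated integral [gaussE] as an integral over tuples *)

Section GaussE.
Context {R : realType}.
Local Open Scope classical_set_scope.
Local Notation RR := (measurableTypeR R).
Local Notation gam := (@normal_prob R 0 1).
Local Notation P := (@stdnormal_tuple R).

Lemma measurable_sum_tuple n (g : R -> R) : measurable_fun setT g ->
  measurable_fun setT (fun s : n.-tuple RR => \sum_(x <- s) g x).
Proof.
move=> mg; rewrite (_ : (fun _ => _) =
    fun s : n.-tuple RR => \sum_(j < n) g (tnth s j)).
  apply: measurable_sum => j; apply: (measurableT_comp mg).
  exact: measurable_tnth.
by apply/funext => s; rewrite big_tuple.
Qed.

(** A sum over the sample is a leave-one-out sum whose [F] ignores the remaining points. *)
Lemma integral_sum_tuple n (g : R -> R) (c : R) : measurable_fun setT g ->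
  (forall x, 0 <= g x) -> (\int[gam]_x (g x)%:E = c%:E)%E ->
  (\int[P n]_s (\sum_(x <- s) g x)%:E = (n%:R * c)%:E)%E.
Proof.
move=> mg g0 gc; pose F (x : R) (_ : seq R) := (g x)%:E.
have F0 x s : (0 <= F x s)%E by rewrite lee_fin.
have mF m : measurable_fun setT (fun z : RR * m.-tuple RR => F z.1 z.2).
  apply/measurable_EFinP; exact: (measurableT_comp mg measurable_fst).
have FE l s : leave_one_out F l s = (\sum_(x <- s) g x)%:E.
  elim: s l => [|x s IH] l /=; first by rewrite big_nil.
  by rewrite IH big_cons EFinD.
have := integral_leave_one_out F0 mF n [::] (fun=> gc).
by under eq_integral do rewrite FE.
Qed.

Lemma integral_sum_tuple_le n (g : R -> R) (c : R) : measurable_fun setT g ->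
  (forall x, 0 <= g x) -> (\int[gam]_x (g x)%:E <= c%:E)%E ->
  (\int[P n]_s (\sum_(x <- s) g x)%:E <= (n%:R * c)%:E)%E.
Proof.
move=> mg g0 gc.
have gfin : (\int[gam]_x (g x)%:E)%E \is a fin_num.
  rewrite ge0_fin_numE ?(le_lt_trans gc) ?ltry//.
  by apply: integral_ge0 => x _; rewrite lee_fin.
rewrite (integral_sum_tuple n mg g0 (esym (fineK gfin))) lee_fin ler_wpM2l//.
by rewrite -lee_fin fineK.
Qed.

Lemma integral_sum_sqr n :
  (\int[P n]_s (\sum_(x <- s) x ^+ 2)%:E = n%:R%:E)%E.
Proof.
rewrite (integral_sum_tuple (c := 1) n (g := fun x => x ^+ 2)) ?mulr1//.
- by move=> x; exact: sqr_ge0.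
- exact: stdnormal_second_moment.
Qed.

Lemma integrable_sum_sqr n :
  (P n).-integrable setT (fun s => (\sum_(x <- s) x ^+ 2)%:E).
Proof.
apply/integrableP; split.
  by apply/measurable_EFinP; exact: (@measurable_sum_tuple _ (fun x => x ^+ 2)).
under eq_integral => s _.
  rewrite gee0_abs; last by rewrite lee_fin sumr_ge0// => x _; rewrite sqr_ge0.
  over.
by rewrite integral_sum_sqr ltry.
Qed.

Lemma integrable_quadratic n (f : n.-tuple RR -> R) (a b : R) :
  measurable_fun setT f ->
  (forall s : n.-tuple RR, `|f s| <= a + b * \sum_(x <- s) x ^+ 2) ->
  (P n).-integrable setT (EFin \o f).
Proof.
move=> mf fab.
have ib : (P n).-integrable setT
    (EFin \o (fun s => a + b * \sum_(x <- s) x ^+ 2)).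
  rewrite (_ : EFin \o _ =
    (cst a%:E \+ (fun s => b%:E * (\sum_(x <- s) x ^+ 2)%:E))%E)//.
  apply: integrableD => //; first exact: finite_measure_integrable_cst.
  apply: integrableZl => //; exact: integrable_sum_sqr.
apply: le_integrable ib => //; first exact/measurable_EFinP.
move=> s _; rewrite /= lee_fin; apply: (le_trans (fab s)); exact: ler_norm.
Qed.

(** The integrals in [gaussE] are real-valued, so integrability is needed at every level of the
    iteration. A quadratic bound passes to the sections of [f], with [a] replaced by
    [a + b * x ^+ 2]. *)
Lemma gaussE_stdnormal_tuple n (f : seq R -> R) (a b : R) :
  measurable_fun setT (fun s : n.-tuple RR => f s) ->
  (forall s : n.-tuple RR, `|f s| <= a + b * \sum_(x <- s) x ^+ 2) ->
  gaussE n f = \int[P n]_s f s.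
Proof.
elim: n f a b => [|n IH] f a b mf fab.
  rewrite /Rintegral /= integral_dirac//=; last exact/measurable_EFinP.
  by rewrite indicT mul1r.
rewrite [RHS]/Rintegral integral_stdnormal_tupleS; last first.
  exact: (integrable_quadratic mf fab).
rewrite /= /Rintegral; congr fine; apply: eq_integral => x _.
have mfx : measurable_fun setT (fun s : n.-tuple RR => f (x :: s)).
  have mc : measurable_fun setT (fun s : n.-tuple RR => [tuple of x :: s]).
    exact: (measurableT_comp (@measurable_tuple_cons R n) (measurable_pair1 x)).
  exact: (measurableT_comp mf mc).
have fx (s : n.-tuple RR) :
    `|f (x :: s)| <= a + b * x ^+ 2 + b * \sum_(y <- s) y ^+ 2.
  by have := fab [tuple of x :: s]; rewrite big_cons mulrDr addrA.
rewrite (IH _ _ _ mfx fx) /Rintegral fineK//.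
exact: (integrable_fin_num measurableT (integrable_quadratic mfx fx)).
Qed.

End GaussE.

(** * Distance from the mean of an order statistic to the quantile *)

Section MeanBound.
Context {R : realType}.
Local Open Scope classical_set_scope.
Local Notation RR := (measurableTypeR R).
Local Notation P := (@stdnormal_tuple R).
Local Notation C := (Num.sqrt (pi / 2) : R).

Lemma sqr_order_stat_le i (s : seq R) : (1 <= i <= size s)%N ->
  (order_stat i s) ^+ 2 <= \sum_(x <- s) x ^+ 2.
Proof.
move=> hi; apply: (@le_sum_mem _ (fun x => x ^+ 2)); last exact: mem_order_stat.
by move=> x; exact: sqr_ge0.
Qed.

Lemma normr_order_stat_le i (s : seq R) : (1 <= i <= size s)%N ->
  `|order_stat i s| <= 1 + 1 * \sum_(x <- s) x ^+ 2.
Proof.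
move=> /sqr_order_stat_le; set x := order_stat i s => h.
have x2 : `|x| ^+ 2 = x ^+ 2 by rewrite real_normK// num_real.
have := sqr_ge0 (`|x| - 1); have := normr_ge0 x; nra.
Qed.

Section fixed_n.
Variable n : nat.

Lemma integrable_order_stat i : (1 <= i <= n)%N ->
  (P n).-integrable setT (EFin \o (fun s : n.-tuple RR => order_stat i s)).
Proof.
move=> hi; apply: (@integrable_quadratic _ _ _ 1 1).
  exact: measurable_order_stat.
by move=> s; apply: normr_order_stat_le; rewrite size_tuple.
Qed.

Lemma gaussE_order_stat i : (1 <= i <= n)%N ->
  gaussE n (order_stat i) = \int[P n]_s order_stat i s.
Proof.
move=> hi; apply: (@gaussE_stdnormal_tuple _ _ _ 1 1).
  exact: measurable_order_stat.
by move=> s; apply: normr_order_stat_le; rewrite size_tuple.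
Qed.

Lemma integrable_ge0_bound (h : n.-tuple RR -> R) (K : R) :
  measurable_fun setT h -> (forall s, 0 <= h s) ->
  (\int[P n]_s (h s)%:E <= K%:E)%E ->
  (P n).-integrable setT (EFin \o h) /\ \int[P n]_s h s <= K.
Proof.
move=> mh h0 hK.
have ih : (P n).-integrable setT (EFin \o h).
  apply/integrableP; split; first exact/measurable_EFinP.
  under eq_integral do rewrite /= ger0_norm//.
  exact: le_lt_trans hK (ltry _).
split => //; rewrite -lee_fin /Rintegral fineK//.
exact: (integrable_fin_num measurableT ih).
Qed.

Lemma affine_Rintegral (f : n.-tuple RR -> R) (a b : R) :
  (P n).-integrable setT (EFin \o f) ->
  (P n).-integrable setT (EFin \o (fun s => a + b * f s)) /\
  \int[P n]_s (a + b * f s) = a + b * \int[P n]_s f s.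
Proof.
move=> intf.
have ia : (P n).-integrable setT (EFin \o cst a) by exact: finite_measure_integrable_cst.
have ib : (P n).-integrable setT (EFin \o (fun s => b * f s)).
  rewrite (_ : _ \o _ = fun s => (b%:E * (EFin \o f) s)%E)//.
  exact: integrableZl.
split.
  rewrite (_ : _ \o _ = ((EFin \o cst a) \+ (EFin \o (fun s => (b * f s)%R)))%E)//.
  exact: integrableD.
rewrite (RintegralD measurableT ia ib) RintegralZl// Rintegral_cst//.
by rewrite [X in fine X]probability_setT mulr1.
Qed.

Section fixed_i.
Variables (i : nat) (q : R).
Hypothesis hi : (1 <= i <= n)%N.
Local Notation X := (fun s : n.-tuple RR => order_stat i s).
Local Notation m := (gaussE n (@order_stat R i)).

Lemma mean_le (h : n.-tuple RR -> R) K :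
  (P n).-integrable setT (EFin \o h) -> \int[P n]_s h s <= K ->
  (forall s : n.-tuple RR, order_stat i s - q <= h s) -> m - q <= K.
Proof.
move=> ih hK Xh; apply: le_trans hK.
have iX := integrable_order_stat hi.
have [iXq e] := affine_Rintegral (- q) 1 iX.
rewrite gaussE_order_stat// addrC -[X in _ + X]mul1r -e.
apply: le_Rintegral => // s _; rewrite mul1r addrC; exact: Xh.
Qed.

Lemma mean_ge (h : n.-tuple RR -> R) K :
  (P n).-integrable setT (EFin \o h) -> \int[P n]_s h s <= K ->
  (forall s : n.-tuple RR, q - order_stat i s <= h s) -> q - m <= K.
Proof.
move=> ih hK Xh; apply: le_trans hK.
have iX := integrable_order_stat hi.
have [iXq e] := affine_Rintegral q (- 1) iX.
rewrite gaussE_order_stat// -[X in _ - X]mul1r -mulNr -e.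
apply: le_Rintegral => // s _; rewrite mulN1r; exact: Xh.
Qed.

Lemma integrable_upper_weight : (i < n)%N ->
  (P n).-integrable setT (EFin \o (fun s : n.-tuple RR => (1 - Phi (X s))^-1)) /\
  \int[P n]_s (1 - Phi (X s))^-1 <= n%:R / (n - i)%:R.
Proof.
move=> ni; have i1 : (1 <= i)%N by case/andP : hi.
apply: integrable_ge0_bound; last by apply: integral_inv_upper; rewrite i1.
  have mw := measurable_inv_gt0 (b := fun a : R => 1 - Phi a).
  apply: (measurableT_comp (mw _ _)); last exact: measurable_order_stat.
    by apply: measurable_funB => //; exact: measurable_Phi.
  by move=> a; rewrite subr_gt0 Phi_lt1.
by move=> s; rewrite invr_ge0 subr_ge0 ltW// Phi_lt1.
Qed.

Lemma integrable_lower_weight : (1 < i)%N ->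
  (P n).-integrable setT (EFin \o (fun s : n.-tuple RR => (Phi (X s))^-1)) /\
  \int[P n]_s (Phi (X s))^-1 <= n%:R / i.-1%:R.
Proof.
move=> i1; have ni : (i <= n)%N by case/andP : hi.
apply: integrable_ge0_bound; last by apply: integral_inv_lower; rewrite i1.
  have mw := measurable_inv_gt0 (@measurable_Phi R) (@Phi_gt0 R).
  apply: (measurableT_comp mw); exact: measurable_order_stat.
by move=> s; rewrite invr_ge0 Phi_ge0.
Qed.

Hypothesis Phi_q : Phi q = i%:R / n.+1%:R.
(** Real counterparts of [i] and [n + 1 - i]: then [n = I + J - 1], [n - i = J - 1], and the algebra
    is free of truncated subtraction. *)
Variables I J : R.
Hypotheses (IE : I = i%:R) (JE : J = (n.+1 - i)%:R).
Local Notation V := (2 / I + 2 / J).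

Let I1 : 1 <= I. Proof. by rewrite IE ler1n; case/andP : hi. Qed.
Let J1 : 1 <= J. Proof. by rewrite JE ler1n subn_gt0 ltnS; case/andP : hi. Qed.
Let n1E : n.+1%:R = I + J.
Proof. by rewrite IE JE -natrD subnKC// ltnW// ltnS; case/andP : hi. Qed.
Let nE : n%:R = I + J - 1. Proof. by rewrite -n1E -natr1 addrK. Qed.
Let IJ0 : I + J != 0. Proof. by rewrite -n1E pnatr_eq0. Qed.
Let PqE : Phi q = I / (I + J). Proof. by rewrite Phi_q n1E IE. Qed.
Let PqE' : 1 - Phi q = J / (I + J).
Proof. by rewrite PqE; field; exact: IJ0. Qed.
Let I0 : 0 < I. Proof. exact: lt_le_trans I1. Qed.
Let J0 : 0 < J. Proof. exact: lt_le_trans J1. Qed.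
Let niE : (n - i)%:R = J - 1.
Proof. by rewrite JE subSn -?natr1 ?addrK//; case/andP : hi. Qed.
Let iE : i.-1%:R = I - 1.
Proof.
have i0 : (0 < i)%N by case/andP : hi.
by rewrite IE -{2}(prednK i0) -natr1 addrK.
Qed.
Let C0 : 0 <= C. Proof. exact/ltW/sqrt_pi_half_gt0. Qed.

Let V0 : 0 < V. Proof. by apply: addr_gt0; exact: divr_gt0. Qed.

(** At an extreme index one summand of [V] equals 2, so there it suffices to bound the error by
    [C]. *)
Let V1 : I = 1 \/ J = 1 -> C <= C * Num.sqrt V.
Proof.
move=> IJ; rewrite ler_peMr// -[leLHS]sqrtr1 ler_wsqrtr//.
have dI : 0 < 2 / I by exact: divr_gt0.
have dJ : 0 < 2 / J by exact: divr_gt0.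
by case: IJ => e; [move: dJ|move: dI]; rewrite e divr1; lra.
Qed.

(** Here [Phi q = n / (n + 1) >= 1/2], so [q >= 0]. The excess of the maximum over [q] is at most
    the sum of the excesses of all points, whose mean is at most
    [n * C * (1 - Phi q) = C * n / (n + 1)]. *)
Lemma upper_end : i = n -> m - q <= C * Num.sqrt V.
Proof.
move=> ein; have J1E : J = 1 by rewrite JE ein subSnn.
have Pq : Phi 0 <= Phi q.
  rewrite Phi0 PqE J1E ler_pdivlMr ?addr_gt0// mul1r mulrC ler_pdivrMr//.
  by move: I1; lra.
have q0 : 0 <= q.
  by rewrite leNgt; apply: contraTN Pq => /Phi_lt; rewrite ltNge.
have mg : measurable_fun setT (fun x : R => Num.max 0 (x - q)).
  by apply: measurable_maxr => //; exact: measurable_funB.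
have g0 x : 0 <= Num.max 0 (x - q) by rewrite le_max lexx.
have [ih hK] := integrable_ge0_bound (measurable_sum_tuple (n := n) mg)
  (fun s => sumr_ge0 _ (fun x _ => g0 x))
  (integral_sum_tuple_le n mg g0 (stdnormal_upper_part q0)).
apply: (mean_le ih) => [|s].
  apply: (le_trans hK); apply: le_trans (V1 (or_intror J1E)).
  have e : (I + 1 - 1) * (C * (1 / (I + 1))) = C * (I / (I + 1)).
    by field; rewrite gt_eqF ?addr_gt0.
  by rewrite nE PqE' J1E e ler_piMr// ler_pdivrMr ?addr_gt0// mul1r lerDl.
apply: (@le_trans _ _ (Num.max 0 (order_stat i s - q))).
  by rewrite le_max lexx orbT.
apply: (@le_sum_mem _ (fun x => Num.max 0 (x - q))) => //.
by apply: mem_order_stat; rewrite size_tuple.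
Qed.

Lemma lower_end : i = 1%N -> q - m <= C * Num.sqrt V.
Proof.
move=> ei; have I1E : I = 1 by rewrite IE ei.
have Pq : Phi q <= Phi 0.
  by rewrite Phi0 PqE I1E !mul1r lef_pV2 ?posrE ?addr_gt0//; move: J1; lra.
have q0 : q <= 0.
  by rewrite leNgt; apply: contraTN Pq => /Phi_lt; rewrite ltNge.
have mg : measurable_fun setT (fun x : R => Num.max 0 (q - x)).
  by apply: measurable_maxr => //; exact: measurable_funB.
have g0 x : 0 <= Num.max 0 (q - x) by rewrite le_max lexx.
have [ih hK] := integrable_ge0_bound (measurable_sum_tuple (n := n) mg)
  (fun s => sumr_ge0 _ (fun x _ => g0 x))
  (integral_sum_tuple_le n mg g0 (stdnormal_lower_part q0)).
apply: (mean_ge ih) => [|s].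
  apply: (le_trans hK); apply: le_trans (V1 (or_introl I1E)).
  have e : (1 + J - 1) * (C * (1 / (1 + J))) = C * (J / (1 + J)).
    by field; rewrite gt_eqF ?addr_gt0.
  by rewrite nE PqE I1E e ler_piMr// ler_pdivrMr ?addr_gt0// mul1r lerDr.
apply: (@le_trans _ _ (Num.max 0 (q - order_stat i s))).
  by rewrite le_max lexx orbT.
apply: (@le_sum_mem _ (fun x => Num.max 0 (q - x))) => //.
by apply: mem_order_stat; rewrite size_tuple.
Qed.

(** The odds of [Phi q] are [1 / J], and [sub_le_odds] integrates to at most [C / 2 * J * (J / (J -
    1) - 1) = C * J / (2 * (J - 1))], which is at most [C] since [J >= 2]. *)
Lemma upper_one : i = 1%N -> (i < n)%N -> m - q <= C * Num.sqrt V.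
Proof.
move=> ei ni; have I1E : I = 1 by rewrite IE ei.
have J2 : 2 <= J by rewrite JE ler_nat ltn_subRL addn1 ltnS.
have [iw wK] := integrable_upper_weight ni.
have [ih hE] := affine_Rintegral (- (C / 2 * J)) (C / 2 * J) iw.
apply: (mean_le ih) => [|s].
  apply: le_trans (V1 (or_introl I1E)); rewrite hE.
  have cJ : 0 <= C / 2 * J by rewrite mulr_ge0 ?divr_ge0//; lra.
  apply: (@le_trans _ _ (- (C / 2 * J) + C / 2 * J * (n%:R / (n - i)%:R))).
    by rewrite lerD2l ler_wpM2l.
  rewrite nE niE I1E (_ : _ + _ = C * (J / (2 * (J - 1)))); last first.
    by field; rewrite !gt_eqF//; lra.
  by rewrite ler_piMr// ler_pdivrMr; lra.
apply: le_trans (sub_le_odds _ q) _.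
rewrite PqE' PqE I1E (_ : J / (1 + J) / (1 / (1 + J)) = J); last first.
  by field; rewrite !gt_eqF//; lra.
by set w := (1 - _)^-1; lra.
Qed.

Lemma lower_last : i = n -> (1 < i)%N -> q - m <= C * Num.sqrt V.
Proof.
move=> ein i1; have J1E : J = 1 by rewrite JE ein subSnn.
have I2 : 2 <= I by rewrite IE ler_nat.
have [iw wK] := integrable_lower_weight i1.
have [ih hE] := affine_Rintegral (- (C / 2 * I)) (C / 2 * I) iw.
apply: (mean_ge ih) => [|s].
  apply: le_trans (V1 (or_intror J1E)); rewrite hE.
  have cI : 0 <= C / 2 * I by rewrite mulr_ge0 ?divr_ge0//; lra.
  apply: (@le_trans _ _ (- (C / 2 * I) + C / 2 * I * (n%:R / i.-1%:R))).
    by rewrite lerD2l ler_wpM2l.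
  rewrite nE iE J1E (_ : _ + _ = C * (I / (2 * (I - 1)))); last first.
    by field; rewrite !gt_eqF//; lra.
  by rewrite ler_piMr// ler_pdivrMr; lra.
apply: le_trans (sub_ge_odds _ q) _.
rewrite PqE' PqE J1E (_ : I / (I + 1) / (1 / (I + 1)) = I); last first.
  by field; rewrite !gt_eqF//; lra.
by set w := (Phi _)^-1; lra.
Qed.

Lemma both_interior : (1 < i)%N -> (i < n)%N -> `|m - q| <= C * Num.sqrt V.
Proof.
move=> i1 ni.
have I2 : 2 <= I by rewrite IE ler_nat.
have J2 : 2 <= J by rewrite JE ler_nat ltn_subRL addn1 ltnS.
have [iu uK] := integrable_upper_weight ni.
have [il lK] := integrable_lower_weight i1.
have inv2 (x : R) : 2 <= x -> (x - 1)^-1 <= 2 / x.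
  move=> x2; rewrite -[leLHS]mul1r ler_pdivrMr; last by lra.
  by rewrite mulrAC ler_pdivlMr; lra.
(* The mean of [t + 1 / t - 2] will be at most [V], so [a = 1 / v] balances [a * V] against [1 / a]:
   both become [v]. *)
pose v := Num.sqrt V; have v0 : 0 < v by rewrite sqrtr_gt0; exact: V0.
have vv : v * v = V by rewrite -expr2 sqr_sqrtr// ltW//; exact: V0.
pose r := J / I; pose c := C / 2 / v.
have c0 : 0 <= c by rewrite !divr_ge0// ltW.
have r0 : 0 < r by rewrite divr_gt0; lra.
have [ih1 hE1] := affine_Rintegral (c * (V - r - r^-1 - 2)) (c * r) iu.
have [ih2 hE2] := affine_Rintegral 0 (c / r) il.
pose h (s : n.-tuple RR) := c * (V - r - r^-1 - 2) + c * r * (1 - Phi (X s))^-1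
  + (0 + c / r * (Phi (X s))^-1).
have ih : (P n).-integrable setT (EFin \o h) by exact: integrableD ih1 ih2.
have hK : \int[P n]_s h s <= C * v.
  rewrite /h RintegralD// hE1 hE2 add0r.
  apply: (@le_trans _ _ (c * (V - r - r^-1 - 2) + c * r * (n%:R / (n - i)%:R)
    + c / r * (n%:R / i.-1%:R))).
    apply: lerD; first by rewrite lerD2l ler_wpM2l// mulr_ge0// ltW.
    by rewrite ler_wpM2l// divr_ge0// ltW.
  rewrite nE niE iE.
  (* The bounds on the means of [t] and [1 / t] are [J / (J - 1) + (n / (n - i) - 1 - I / (J - 1)) *
     r] and its mirror image; the bracket vanishes, and subtracting 2 leaves the two inverses. *)
  rewrite (_ : _ + _ = c * (V + ((J - 1)^-1 + (I - 1)^-1))); last first.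
    by rewrite /r; field; rewrite !gt_eqF//; lra.
  apply: (@le_trans _ _ (c * (V + V))).
    rewrite ler_wpM2l// lerD2l addrC lerD//.
      exact: inv2.
    exact: inv2.
  rewrite /c -vv le_eqVlt; apply/orP; left; apply/eqP; field.
  by rewrite gt_eqF.
have Xh (s : n.-tuple RR) : `|order_stat i s - q| <= h s.
  apply: le_trans (dist_le_odds _ q (a := v^-1) _) _; first by rewrite invr_gt0.
  rewrite PqE' PqE (_ : J / (I + J) / (I / (I + J)) = r); last first.
    by rewrite /r; field; rewrite !gt_eqF//; lra.
  rewrite /h /c invrK; set w := (1 - _)^-1; set u := (Phi _)^-1.
  rewrite le_eqVlt; apply/orP; left; apply/eqP; rewrite -vv; field.
  by rewrite !gt_eqF.
rewrite ler_norml lerNl opprB; apply/andP; split.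
  apply: (mean_ge ih hK) => s; apply: le_trans (Xh s).
  by rewrite distrC ler_norm.
by apply: (mean_le ih hK) => s; apply: le_trans (Xh s); exact: ler_norm.
Qed.

Lemma order_stat_mean_dist : `|m - q| <= C * Num.sqrt V.
Proof.
have [i1 ni] := andP hi.
have [i2|i2] := ltnP 1 i; have [ni2|ni2] := ltnP i n.
- exact: both_interior.
- have e : i = n by apply/eqP; rewrite eqn_leq ni.
  by rewrite ler_norml lerNl opprB upper_end// lower_last.
- have e : i = 1%N by apply/eqP; rewrite eqn_leq i1 i2.
  by rewrite ler_norml lerNl opprB lower_end// upper_one.
- have e : i = n by apply/eqP; rewrite eqn_leq ni.
  have e1 : i = 1%N by apply/eqP; rewrite eqn_leq i1 i2.
  by rewrite ler_norml lerNl opprB lower_end// upper_end.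
Qed.
End fixed_i.
End fixed_n.
End MeanBound.

(** * Variance *)

Section VarianceBound.
Context {R : realType}.
Local Open Scope classical_set_scope.
Local Notation RR := (measurableTypeR R).
Local Notation P := (@stdnormal_tuple R).

Lemma integrable_Rintegral_sum n (r : seq nat) (F : nat -> n.-tuple RR -> R) :
  (forall k, k \in r -> (P n).-integrable setT (EFin \o F k)) ->
  (P n).-integrable setT (EFin \o (fun s => \sum_(k <- r) F k s)) /\
  \int[P n]_s (\sum_(k <- r) F k s) = \sum_(k <- r) \int[P n]_s F k s.
Proof.
elim: r => [|k r IH] iF.
  rewrite big_nil (_ : (fun _ => _) = cst 0); last first.
    by apply/funext => s; rewrite big_nil.
  split; first exact: finite_measure_integrable_cst.
  by rewrite Rintegral_cst// mul0r.
have [l lr|i1 e1] := IH; first by apply: iF; rewrite inE lr orbT.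
have i0 : (P n).-integrable setT (EFin \o F k) by apply: iF; rewrite mem_head.
rewrite (_ : (fun _ => _) = fun s => F k s + \sum_(k <- r) F k s); last first.
  by apply/funext => s; rewrite big_cons.
split; first exact: integrableD i0 i1.
by rewrite RintegralD// e1 big_cons.
Qed.

(** Sorting preserves the sum of squares, whose mean is [n]; expanding the squares around the means
    gives the rest. *)
Lemma var_sortedE n : var_sorted n =
  n%:R - \sum_(1 <= i < n.+1) (gaussE n (@order_stat R i)) ^+ 2.
Proof.
pose m i := gaussE n (@order_stat R i).
have sumE (s : n.-tuple RR) :
    \sum_(1 <= i < n.+1) (order_stat i s) ^+ 2 = \sum_(x <- s) x ^+ 2.
  have := @sum_order_stat R R (fun x => x ^+ 2) s; by rewrite size_tuple.
have mi i : i \in index_iota 1 n.+1 -> (1 <= i <= n)%N by rewrite mem_index_iota ltnS.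
(* The quadratic bound comes from [(x - m) ^+ 2 <= 2 * m ^+ 2 + 2 * x ^+ 2]. *)
rewrite /var_sorted (@gaussE_stdnormal_tuple _ _ _
  (2 * \sum_(1 <= i < n.+1) m i ^+ 2) 2); first last.
- move=> s; rewrite ger0_norm; last by apply: sumr_ge0 => i _; rewrite sqr_ge0.
  rewrite -sumE -mulrDr -big_split mulr_sumr; apply: ler_sum => i _ /=.
  rewrite -/(m i) -subr_ge0.
  rewrite (_ : _ - _ = (order_stat i s + m i) ^+ 2) ?sqr_ge0//; ring.
- apply: measurable_sum => i; apply: measurable_funX; apply: measurable_funB => //.
  exact: measurable_order_stat.
have [iL eL] := @integrable_Rintegral_sum n (index_iota 1 n.+1)
  (fun i s => 0 + m i * order_stat i s)
  (fun i hi => (affine_Rintegral 0 (m i) (integrable_order_stat (mi i hi))).1).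
have [iq eq] := affine_Rintegral (\sum_(1 <= i < n.+1) m i ^+ 2) 1
  (integrable_sum_sqr n).
have [il el] := affine_Rintegral 0 (- 2) iL.
transitivity (\int[P n]_s (\sum_(1 <= i < n.+1) m i ^+ 2 + 1 * \sum_(x <- s) x ^+ 2
    + (0 + - 2 * \sum_(1 <= i < n.+1) (0 + m i * order_stat i s)))).
  apply: eq_Rintegral => s _; rewrite mul1r -sumE -big_split add0r mulr_sumr.
  rewrite -big_split; apply: eq_bigr => i _ /=; rewrite -/(m i); ring.
rewrite RintegralD// eq el eL mul1r add0r.
rewrite [X in _ + X + _](_ : _ = n%:R); last first.
  by rewrite /Rintegral integral_sum_sqr.
rewrite (_ : \sum_(i <- _) _ = \sum_(1 <= i < n.+1) m i ^+ 2); first by ring.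
rewrite !big_seq; apply: eq_bigr => i hi.
have [_ ->] := affine_Rintegral 0 (m i) (integrable_order_stat (mi i hi)).
by rewrite add0r -gaussE_order_stat ?mi// expr2.
Qed.

Lemma gaussE_ge0 n (f : seq R -> R) : (forall s, 0 <= f s) -> 0 <= gaussE n f.
Proof.
by elim: n f => //= n IH f f0; apply: Rintegral_ge0 => x _; exact: IH.
Qed.

(** The difference of the two sides is [var_sorted n], the mean of a nonnegative function. *)
Lemma sum_sqr_mean_le n :
  \sum_(1 <= i < n.+1) (gaussE n (@order_stat R i)) ^+ 2 <= n%:R.
Proof.
rewrite -subr_ge0 -var_sortedE; apply: gaussE_ge0 => s.
by apply: sumr_ge0 => i _; exact: sqr_ge0.
Qed.

(** Cauchy-Schwarz through weighted AM-GM: the weights [S / a] and [a / S] make the two sums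
    contribute at most [S] each. *)
Lemma sum_normM_le (r : seq nat) (m d : nat -> R) (a b : R) :
  0 < a -> 0 < b ->
  \sum_(i <- r) m i ^+ 2 <= a -> \sum_(i <- r) d i ^+ 2 <= b ->
  \sum_(i <- r) (2 * `|m i * d i|) <= 2 * Num.sqrt (a * b).
Proof.
move=> a0 b0 ma db; set S := Num.sqrt (a * b).
have S0 : 0 < S by rewrite sqrtr_gt0 mulr_gt0.
have SS : S * S = a * b by rewrite -expr2 sqr_sqrtr// ltW// mulr_gt0.
apply: (@le_trans _ _ (\sum_(i <- r) (S / a * m i ^+ 2 + a / S * d i ^+ 2))).
  apply: ler_sum => i _; rewrite normrM -[m i ^+ 2]real_normK ?num_real//.
  rewrite -[d i ^+ 2]real_normK ?num_real// -subr_ge0.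
  rewrite (_ : _ - _ = (S * `|m i| - a * `|d i|) ^+ 2 / (a * S)).
    by rewrite divr_ge0 ?sqr_ge0//; exact/ltW/mulr_gt0.
  by field; rewrite !gt_eqF.
rewrite big_split -!mulr_sumr /=.
apply: (@le_trans _ _ (S / a * a + a / S * b)).
  by rewrite lerD// ler_wpM2l// divr_ge0// ltW.
rewrite divfK ?gt_eqF// mulrAC -SS mulfK ?gt_eqF//; lra.
Qed.

(** By [ln (1 - x) <= - x] at [x = 1 / (n + 2)], each new term is at most the increment of the
    logarithm. *)
Lemma sum_inv_le n : (0 < n)%N ->
  \sum_(1 <= i < n.+1) i%:R^-1 <= 1 + ln (n%:R : R).
Proof.
case: n => // n _; elim: n => [|n IH].
  by rewrite big_nat1 ln1 addr0 invr1.
rewrite big_nat_recr//=; apply: (le_trans (lerD IH (lexx _))).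
rewrite -addrA lerD2l.
have n0 : 0 < n.+1%:R :> R by rewrite ltr0n.
have n1 : 0 < n.+2%:R :> R by rewrite ltr0n.
have := @le_ln1Dx R (- n.+2%:R^-1).
have -> : 1 + - n.+2%:R^-1 = n.+1%:R / n.+2%:R :> R.
  have -> : n.+1%:R = n.+2%:R - 1 :> R by rewrite -(natr1 n.+1) addrK.
  by set y := n.+2%:R in n1 *; field; rewrite gt_eqF.
rewrite ln_div ?posrE// => h.
have H (u v t : R) : u - v <= - t -> u + t <= v by lra.
by apply/H/h; rewrite ltrN2 invf_lt1// ltr1n.
Qed.

(** The reflection of [i] to [n + 1 - i] identifies the two harmonic sums, so the total is at most
    [pi / 2 * 4 * (1 + ln n)]. *)
Lemma sum_mean_dist_le n (q : nat -> R) : (0 < n)%N ->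
  (forall i, (1 <= i <= n)%N -> Phi (q i) = i%:R / n.+1%:R) ->
  \sum_(1 <= i < n.+1) (gaussE n (@order_stat R i) - q i) ^+ 2 <=
  (3 * pi / 2) * (2 * ln n%:R + n%:R^-1 + 1).
Proof.
move=> n0 Pq; have pi0 := @pi_gt0 R.
apply: (@le_trans _ _ (\sum_(1 <= i < n.+1) (pi / 2 * (2 / i%:R + 2 / (n.+1 - i)%:R)))).
  rewrite big_nat [leRHS]big_nat; apply: ler_sum => i hi.
  have V0 : 0 <= 2 / i%:R + 2 / (n.+1 - i)%:R :> R by rewrite addr_ge0 ?divr_ge0.
  have h := order_stat_mean_dist hi (Pq i hi) erefl erefl.
  rewrite -real_normK ?num_real//.
  apply: (le_trans (lerXn2r 2 _ _ h)); rewrite ?nnegrE ?mulr_ge0 ?sqrtr_ge0//.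
  by rewrite exprMn !sqr_sqrtr// divr_ge0// ltW.
rewrite -mulr_sumr big_split/=.
have -> : \sum_(1 <= i < n.+1) (2 / (n.+1 - i)%:R : R) =
    \sum_(1 <= i < n.+1) 2 / i%:R.
  by rewrite [RHS]big_nat_rev/=; apply: eq_bigr => i _; rewrite add1n subSS.
rewrite -mulr_sumr.
have H := sum_inv_le n0.
(* This lower bound yields [4 * (1 + ln n) <= 3 * (2 * ln n + 1 / n + 1)]. *)
have L : 1 - n%:R^-1 <= ln (n%:R : R).
  have n1 : 0 < n%:R^-1 :> R by rewrite invr_gt0 ltr0n.
  have := @le_ln1Dx R (n%:R^-1 - 1).
  by rewrite ltrBrDr addNr n1 addrC subrK lnV ?posrE ?ltr0n// => /(_ isT); lra.
have N0 : 0 <= n%:R^-1 :> R by rewrite invr_ge0.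
rewrite (_ : 3 * pi / 2 * _ = pi / 2 * (3 * (2 * ln n%:R + n%:R^-1 + 1))); last by ring.
rewrite ler_pM2l ?divr_gt0//; lra.
Qed.
End VarianceBound.

(** * Both estimates at the quantiles of [i / (n + 1)] *)

Theorem theorem8 (R : realType) (n : nat) (hn : (0 < n)%N) :
  (forall i : nat, (1 <= i <= n)%N ->
     `| gaussE n (order_stat i) - Phi_inv (i%:R / n.+1%:R) |
       <= Num.sqrt (pi / 2) *
          Num.sqrt (2 / i%:R + 2 / (n.+1 - i)%:R
                    + `| i%:R^-1 - (2 * (n.+1 - i)%:R)^-1 | ^+ 2 :> R))
  /\
  `| var_sorted n - (n%:R - \sum_(1 <= i < n.+1) Phi_inv (i%:R / n.+1%:R) ^+ 2) |
    <= 2 * Num.sqrt (18 * n.+1%:R * (3 * pi / 2) * (2 * ln n%:R + n%:R^-1 + 1))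
       + (3 * pi / 2) * (2 * ln n%:R + n%:R^-1 + 1) :> R.
Proof.
pose q i : R := Phi_inv (i%:R / n.+1%:R).
have Pq i : (1 <= i <= n)%N -> Phi (q i) = i%:R / n.+1%:R.
  move=> /andP[i1 ni]; apply: Phi_invK.
  by rewrite divr_gt0 ?ltr0n//= ltr_pdivrMr ?ltr0n// mul1r ltr_nat ltnS.
split=> [i hi|].
  apply: (le_trans (order_stat_mean_dist hi (Pq i hi) erefl erefl)).
  rewrite ler_wpM2l ?sqrtr_ge0// ler_wsqrtr// lerDl exprn_ge0//.
have pi0 := @pi_gt0 R.
set L := 2 * ln _ + _ + _; set D := 3 * pi / 2 * L.
have n0 : 0 < n%:R :> R by rewrite ltr0n.
have D0 : 0 < D.
  rewrite /D /L mulr_gt0 ?divr_gt0 ?mulr_gt0// ltr_wpDl// addr_ge0 ?invr_ge0//.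
  by rewrite mulr_ge0 ?ln_ge0 ?ler1n.
pose m i := gaussE n (@order_stat R i); pose d i := m i - q i.
have dD : \sum_(1 <= i < n.+1) d i ^+ 2 <= D by exact: sum_mean_dist_le.
have md := sum_normM_le n0 D0 (sum_sqr_mean_le n) dD.
rewrite var_sortedE opprB addrC addrA subrK -sumrB -/m -/q.
(* With [q = m - d], the squares [d ^+ 2] sum to at most [D], and Cauchy-Schwarz with
   [sum_sqr_mean_le] bounds the cross terms by [2 * Num.sqrt (n * D)]. *)
have -> : \sum_(1 <= i < n.+1) (q i ^+ 2 - m i ^+ 2) =
    \sum_(1 <= i < n.+1) (d i ^+ 2 - 2 * (m i * d i)).
  by apply: eq_bigr => i _; rewrite /d; ring.
apply: (le_trans (ler_norm_sum _ _ _)).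
apply: (@le_trans _ _ (\sum_(1 <= i < n.+1) (2 * `|m i * d i| + d i ^+ 2))).
  apply: ler_sum => i _; apply: (le_trans (ler_normB _ _)).
  by rewrite addrC (normrM 2) (ger0_norm (ler0n R 2)) (ger0_norm (sqr_ge0 _)).
rewrite big_split/= lerD//; apply: (le_trans md).
(* Under the root it remains to compare [n] with [18 * (n + 1)]. *)
rewrite ler_wpM2l// ler_wsqrtr// -mulrA -/D ler_wpM2r//; first exact: ltW.
rewrite -[leLHS]mul1r ler_pM// ?ler_nat//; lra.
Qed.
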